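(* The limit $$\lim_{T\to\infty}\frac1T\log \mathrm{P}\Bigl(\sup_{0\le t\le T}Y_t\le0\Bigr)$$ exists, and the constant $$b:=-4\lim_{T\to\infty}\frac1T\log \mathrm{P}\Bigl(\sup_{0\le t\le T}Y_t\le0\Bigr)$$ satisfies the bounds $0.4\le b\le 2$.
   Context: $\log$ is the natural logarithm. $(Y_t)_{t\in\mathbb{R}}$ is the centered stationary Gaussian process with continuous sample paths and correlation function $E(Y_sY_t)=\operatorname{sech}((t-s)/2)$, where $\operatorname{sech}(u)=2/(e^u+e^{-u})$. *)

(* Defs.v *)
From HB Require Import structures.
From mathcomp Require Import all_boot all_order all_algebra.
From mathcomp Require Import all_classical all_reals all_analysis.
Set Implicit Arguments.
Unset Strict Implicit.
Unset Printing Implicit Defensive.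
Import Order.TTheory GRing.Theory Num.Theory.
Import numFieldNormedType.Exports.
Local Open Scope classical_set_scope.
Local Open Scope ring_scope.

Definition sech (R : realType) (u : R) : R := 2 / (expR u + expR (- u)).

(* Point masses are listed separately because the library's [normal_prob m 0]
   is the uniform law on [0, 1], not the Dirac mass at [m]. *)
Definition gaussian_law (R : realType) (mu : set R -> \bar R) : Prop :=
  exists m s : R, 0 <= s /\
    forall B : set R, measurable B ->
      mu B = if s == 0 then \d_m B else normal_prob m s B.

Section process.
Context (R : realType) (d : measure_display) (Omega : measurableType d)
  (P : probability Omega R) (Y : R -> {RV P >-> R}).

Definition gaussian_process : Prop :=
  forall (n : nat) (t a : 'I_n -> R),
    gaussian_law (pushforward P (fun w => \sum_(i < n) a i * Y (t i) w)).

Definition centered_process : Prop := forall t : R, ('E_P[Y t] = 0)%E.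

Definition stationary_process : Prop :=
  forall (n : nat) (t : 'I_n -> R) (h : R) (B : set (n.-tuple R)),
    measurable B ->
    pushforward P (fun w => [tuple Y (t i + h) w | i < n]) B =
    pushforward P (fun w => [tuple Y (t i) w | i < n]) B.

Definition continuous_paths : Prop :=
  forall w : Omega, continuous (fun t : R => Y t w).

Definition sech_correlated : Prop :=
  forall s t : R,
    ('E_P[fun w => (Y s w * Y t w)%R] = (sech ((t - s) / 2))%:E)%E.

Definition sech_gaussian_process : Prop :=
  [/\ gaussian_process, centered_process, stationary_process,
      continuous_paths & sech_correlated].

Definition stays_nonpositive (T : R) : set Omega :=
  [set w | sup [set Y t w | t in `[0, T]] <= 0].

End process.

(* Main.v *)
(* Since [sech u * sech v + tanh u * tanh v * sech (v - u) = sech (v - u)], the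
   process can be resampled at any time [s]: in law,
   [Y_t = sech ((t - s) / 2) * Y_s + tanh ((t - s) / 2) * Y'_t] jointly in [t],
   with [Y'] an independent copy of [Y].
   - To the right of [s] both coefficients are nonnegative, so induction on the
     number of times and Chebyshev's inequality for two monotone functions of
     [Y_s] show that decreasing events are positively correlated. With
     stationarity, [p T = P (sup_[0, T] Y <= 0)] satisfies
     [p S * p T <= p (S + T)], and Fekete's lemma gives the limit [l], which is
     the supremum of [ln (p T) / T].
   - Resampling at [s] bounds the probability of [Y_s <= 0 < Y_u] by
     [sinh ((u - s) / 2) / (2 * pi)]; summing over finer and finer grids,
     [p T >= 1 / 2 - T / (4 * pi)], and [T = 7 / 2] gives [l >= - 1 / 2].
   - Resampling successively at [t 0 < t 1 < ...] gives the density of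
     [(Y (t i))_(i < n)]. With [lam] a bound on the row sums of the covariance
     matrix and [D] the square root of its determinant, the density is at most
     [exp (- |y|^2 / (2 * lam)) / (D * sqrt (2 * pi) ^ n)], so the [Y (t i)] are
     all nonpositive with probability at most [(sqrt lam / 2) ^ n / D]. On a grid
     of mesh [2 * ln 10] this gives [l <= - 1 / 10]. *)
Require Import Defs.
From HB Require Import structures.
From mathcomp Require Import all_boot all_order all_algebra.
From mathcomp Require Import all_classical all_reals all_analysis.
From mathcomp Require Import measurable_realfun ring lra.
Import Order.TTheory GRing.Theory Num.Theory.
Import numFieldNormedType.Exports.
Set Implicit Arguments.
Unset Strict Implicit.
Unset Printing Implicit Defensive.
Local Open Scope classical_set_scope.
Local Open Scope ring_scope.

(** [gaussian_process] only says that linear combinations of values of [Y] have some Gaussian law;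
    mean and variance come from the other hypotheses. The resampling identity is therefore checked
    one combination at a time: both sides have the same variance, and a Cramer-Wold argument passes
    to joint laws. The test functions are [1 + cos], which are nonnegative, so that Tonelli and the
    changes of variables apply at once.

    The loss [T / (4 * pi)] in the lower bound is Rice's formula: the correlation has second
    derivative [- 1 / 4] at 0, so upcrossings of 0 occur at rate [1 / (4 * pi)]. The time [7 / 2] is
    near the maximum of [ln (1 / 2 - T / (4 * pi)) / T], and [l >= - 1 / 2] follows there from
    [p (7 / 2) >= exp (- 7 / 4)].

    In the upper bound a wider mesh brings the factor gained per grid point closer to [1 / 2], but
    spends more time on it; with [2 * ln 10] all constants are rational and the resulting rate still
    exceeds [1 / 10]. *)

Definition image_measure d d' (T1 : measurableType d) (T2 : measurableType d')
    (R : realFieldType) (m : {measure set T1 -> \bar R}) (f : T1 -> T2)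
    (mf : measurable_fun setT f) : {measure set T2 -> \bar R}.
Proof. by refine (pushforward m f : {measure set T2 -> \bar R}). Defined.

Lemma ge0_integral_image d d' (T1 : measurableType d) (T2 : measurableType d')
    (R : realType) (m : {measure set T1 -> \bar R}) (f : T1 -> T2)
    (mf : measurable_fun setT f) (g : T2 -> \bar R) :
  measurable_fun setT g -> (forall y, 0 <= g y)%E ->
  (\int[image_measure m mf]_y g y = \int[m]_x g (f x))%E.
Proof. by move=> mg g0; rewrite ge0_integral_pushforward. Qed.

(** * Gaussian integrals *)

Section affine_lebesgue.
Context (R : realType).
Notation mu := (@lebesgue_measure R).

Lemma measurable_affine (a b : R) : measurable_fun setT (fun x : R => a + b * x).
Proof. by apply: measurable_funD => //; apply: measurable_funM. Qed.

Lemma lebesgue_measure_affine (a b : R) (A : set R) : 0 < b -> measurable A ->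
  mu A = (b%:E * mu ((fun x => (a + b * x)%R) @^-1` A))%E.
Proof.
move=> b0 mA; pose nu : {measure set (measurableTypeR R) -> \bar R} := mscale (NngNum (ltW b0))
  (@image_measure _ _ (measurableTypeR R) (measurableTypeR R) R mu _
    (measurable_affine a b)).
rewrite (@lebesgue_measure_unique _ nu) => [//|X|//].
move=> /ocitvP[->|[[u v]/= uv ->]]; first by rewrite !measure0.
rewrite /nu /mscale/= /pushforward/=.
have -> : (fun x => a + b * x) @^-1` `]u, v] = `](u - a) / b, (v - a) / b]%classic.
  apply/seteqP; split => x /=; rewrite !in_itv/= ltr_pdivrMr// ler_pdivlMr//;
    by move=> /andP[? ?]; apply/andP; split; lra.
rewrite !lebesgue_measure_itv/= !lte_fin uv ltr_pM2r ?invr_gt0// ltrD2r uv.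
by rewrite -!EFinB -EFinM; congr EFin; field; rewrite gt_eqF.
Qed.

Lemma ge0_integral_affine (a b : R) (f : R -> \bar R) : 0 < b ->
  measurable_fun setT f -> (forall x, 0 <= f x)%E ->
  (\int[mu]_x f x = b%:E * \int[mu]_x f (a + b * x)%R)%E.
Proof.
move=> b0 mf f0.
transitivity (\int[mscale (NngNum (ltW b0))
  (@image_measure _ _ (measurableTypeR R) (measurableTypeR R) R mu _
    (measurable_affine a b))]_x f x)%E.
  apply: eq_measure_integral => A mA _.
  exact: lebesgue_measure_affine.
rewrite ge0_integral_mscale//= ge0_integral_image//.
exact: measurable_affine.
Qed.

Lemma ge0_integral_opp (f : R -> \bar R) :
  measurable_fun setT f -> (forall x, 0 <= f x)%E ->
  (\int[mu]_x f x = \int[mu]_x f (- x)%R)%E.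
Proof.
move=> mf f0.
have mN : measurable_fun setT (@GRing.opp R) by [].
rewrite -(@ge0_integral_image _ _ (measurableTypeR R) (measurableTypeR R) R mu _ mN)//.
by apply: eq_measure_integral => A mA _; rewrite /= lebesgue_measureN.
Qed.

End affine_lebesgue.

Section normal_integral.
Context (R : realType) (m s : R).
Notation mu := (@lebesgue_measure R).
Notation gamma := (normal_prob m s : probability _ R).
Notation phi := (normal_pdf m s).

Lemma measurable_phi : measurable_fun setT (fun x => (phi x)%:E).
Proof. by apply/measurable_EFinP; exact: measurable_normal_pdf. Qed.

Import Radon_Nikodym_SigmaFinite.

(** The change of variables produces the Radon-Nikodym derivative of [gamma], which equals [phi]
    almost everywhere because both have the same integral over every measurable set. *)
Lemma ge0_integral_normal_prob (g : R -> \bar R) :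
  measurable_fun setT g -> (forall x, 0 <= g x)%E ->
  (\int[gamma]_x g x = \int[mu]_x (g x * (phi x)%:E))%E.
Proof.
move=> mg g0.
have dom : gamma `<< mu := @normal_prob_dominates R m s.
have intd := f_integrable dom.
rewrite -(change_of_variables dom)//.
apply: ae_eq_integral => //.
- by apply: emeasurable_funM => //; exact: measurable_int intd.
- by apply: emeasurable_funM => //; exact: measurable_phi.
apply: ae_eqe_mul2l.
apply: integral_ae_eq => //; first exact: measurable_phi.
by move=> E _ mE; rewrite -f_integral.
Qed.

End normal_integral.

Section standard_normal.
Context (R : realType).
Notation mu := (@lebesgue_measure R).
Notation gamma := (normal_prob 0 1 : probability _ R).
Notation phi := (normal_pdf (0 : R) 1).

Lemma integral_prob_cst d (T : measurableType d) (P : probability T R) (c : \bar R) :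
  (\int[P]_x c = c)%E.
Proof.
by rewrite (integral_cst P measurableT) -[X in _ = X]mule1 -[in RHS](@probability_setT _ _ _ P).
Qed.

Lemma measurable_comp_affine (g : R -> \bar R) (a b : R) : measurable_fun setT g ->
  measurable_fun setT (fun x : R => g (a + b * x)%R).
Proof. by move=> mg; exact: (measurableT_comp mg (measurable_affine a b)). Qed.

Lemma std_normal_pdfE x : phi x = normal_peak 1 * expR (- x ^+ 2 / 2).
Proof. by rewrite normal_pdfE ?oner_eq0// /normal_fun subr0 expr1n. Qed.

Lemma normal_peak_scale (s : R) : 0 < s -> s * normal_peak s = normal_peak 1.
Proof.
move=> s0; rewrite /normal_peak expr1n mul1r -mulrnAr sqrtrM ?sqr_ge0//.
by rewrite sqrtr_sqr gtr0_norm// invfM mulrA divff ?gt_eqF// mul1r.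
Qed.

Lemma ge0_integral_gammaN (g : R -> \bar R) :
  measurable_fun setT g -> (forall x, 0 <= g x)%E ->
  (\int[gamma]_x g (- x)%R = \int[gamma]_x g x)%E.
Proof.
move=> mg g0; rewrite !ge0_integral_normal_prob//; last first.
  exact: measurableT_comp.
rewrite [RHS]ge0_integral_opp.
- by apply: eq_integral => x _; rewrite !std_normal_pdfE sqrrN.
- by apply: emeasurable_funM; [exact: mg|exact: measurable_phi].
- by move=> x; rewrite mule_ge0// lee_fin normal_pdf_ge0.
Qed.

Lemma measurable_comp_lin2 (g : R -> \bar R) (a b : R) : measurable_fun setT g ->
  measurable_fun setT (fun z : R * R => g (a * z.1 + b * z.2)%R).
Proof.
move=> mg; apply: (measurableT_comp mg).
by apply: measurable_funD; apply: measurable_funM.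
Qed.

(* The kernel [phi x * phi ((u - a * x) / b)] is symmetric in [x] and [u]. *)
Lemma normal_rotation_unit (a b : R) (g : R -> \bar R) : a ^+ 2 + b ^+ 2 = 1 ->
  0 < b -> measurable_fun setT g -> (forall x, 0 <= g x)%E ->
  (\int[gamma]_x \int[gamma]_y g (a * x + b * y)%R = \int[gamma]_x g x)%E.
Proof.
move=> ab b0 mg g0.
have phi0 x : (0 <= (phi x)%:E)%E by rewrite lee_fin normal_pdf_ge0.
have mphi := @measurable_phi R 0 1.
have mphiE : measurable_fun setT phi by exact/measurable_EFinP.
have bV0 : 0 < b^-1 by rewrite invr_gt0.
(* Joint density of [x] and [u = a * x + b * y]: solving for [y] gives the argument of the first
   [phi], and [b^-1] is the Jacobian. *)
pose k (x u : R) := b^-1 * (phi (- (a * x / b) + b^-1 * u) * phi x).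
have kC x u : k x u = k u x.
  rewrite /k !std_normal_pdfE; congr (_ * _).
  rewrite mulrACA [RHS]mulrACA -!expRD; congr (_ * expR _).
  have E v w : - (- (a * v / b) + b^-1 * w) ^+ 2 / 2 + - v ^+ 2 / 2 =
      - ((a ^+ 2 + b ^+ 2) * v ^+ 2 - 2 * a * v * w + w ^+ 2) / (2 * b ^+ 2).
    by field; rewrite gt_eqF.
  by rewrite !E ab; congr (_ / _); ring.
have k0 x u : 0 <= k x u.
  by rewrite /k !mulr_ge0 ?normal_pdf_ge0// ltW.
have mk : measurable_fun setT (fun z : R * R => k z.1 z.2).
  apply: measurable_funM => //; apply: measurable_funM.
    apply: (measurableT_comp mphiE); apply: measurable_funD => //.
      by apply: measurable_funN; apply: measurable_funM => //; exact: measurable_funM.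
    exact: measurable_funM.
  by apply: (measurableT_comp mphiE).
have gin x : (\int[gamma]_y g (a * x + b * y)%R * (phi x)%:E =
    \int[mu]_u (g u * (k x u)%:E))%E.
  rewrite ge0_integral_normal_prob//; last exact: measurable_comp_affine.
  have mF : measurable_fun setT (fun y : R => g (a * x + b * y)%R * (phi y)%:E)%E.
    by apply: emeasurable_funM => //; exact: measurable_comp_affine.
  rewrite (ge0_integral_affine (- (a * x / b)) bV0)//; last first.
    by move=> y; rewrite mule_ge0.
  rewrite muleAC -ge0_integralZl//; last 3 first.
  - exact: measurable_comp_affine mF.
  - by move=> u _; rewrite !mule_ge0.
  - by rewrite mule_ge0// lee_fin ltW.
  apply: eq_integral => u _.
  have -> : a * x + b * (- (a * x / b) + b^-1 * u) = u by field; rewrite gt_eqF.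
  by rewrite muleCA -!EFinM; congr (_ * _%:E)%E; rewrite /k; ring.
rewrite ge0_integral_normal_prob//; last 2 first.
- apply: (@measurable_fun_fubini_tonelli_F _ _ _ _ _ gamma
    (fun z : R * R => g (a * z.1 + b * z.2)%R)) => //.
  exact: measurable_comp_lin2.
- by move=> x; apply: integral_ge0 => y _.
under eq_integral do rewrite gin.
rewrite (@fubini_tonelli _ _ _ _ _ mu mu (fun z => g z.2 * (k z.1 z.2)%:E)%E)/=; last 2 first.
- apply: emeasurable_funM; first exact: measurableT_comp.
  exact/measurable_EFinP.
- by move=> z; rewrite mule_ge0// lee_fin.
rewrite ge0_integral_normal_prob//; apply: eq_integral => u _.
rewrite ge0_integralZl//; last 2 first.
- apply/measurable_EFinP; exact: (measurableT_comp mk (pair2_measurable u)).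
- by move=> x _; rewrite lee_fin.
congr (_ * _)%E.
(* By symmetry of [k], what depends on [x] is a normal density composed with an affine map of slope
   [b^-1], and its integral times [b^-1] is 1. *)
transitivity (\int[mu]_x ((phi u)%:E * (b^-1%:E *
    (phi (- (a * u / b) + b^-1 * x))%:E)))%E.
  by apply: eq_integral => x _; rewrite kC /k -!EFinM; congr EFin; ring.
have mph : measurable_fun setT (fun x : R => (phi (- (a * u / b) + b^-1 * x))%:E).
  exact: (measurable_comp_affine _ _ mphi).
rewrite ge0_integralZl//; last 2 first.
- exact: emeasurable_funM.
- by move=> x _; rewrite mule_ge0// lee_fin ltW.
rewrite ge0_integralZl// ?lee_fin ?ltW//.
by rewrite -(ge0_integral_affine _ bV0 mphi)// integral_normal_pdf mule1.
Qed.

(** Dividing by the norm of [(a, b)] reduces to a unit vector, and the symmetry of [gamma] to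
    [0 <= b]. The case [b = 0] is separate because the kernel of the unit case divides by [b]. *)
Lemma normal_rotation (a b : R) (g : R -> \bar R) :
  measurable_fun setT g -> (forall x, 0 <= g x)%E ->
  (\int[gamma]_x \int[gamma]_y g (a * x + b * y)%R =
   \int[gamma]_x g (Num.sqrt (a ^+ 2 + b ^+ 2) * x)%R)%E.
Proof.
move=> mg g0; wlog b0 : b / 0 <= b.
  move=> H; have [/H//|/ltW b0] := leP 0 b.
  rewrite -(sqrrN b) -H ?oppr_ge0//; apply: eq_integral => x _.
  rewrite -ge0_integral_gammaN//; last exact: measurable_comp_affine.
  by apply: eq_integral => y _; rewrite mulrN mulNr.
have mgr (r : R) : measurable_fun setT (fun x : R => g (r * x)).
  by apply: (measurableT_comp mg); exact: measurable_funM.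
move: b0; rewrite le_eqVlt => /predU1P[<-|b0].
  rewrite expr0n addr0 sqrtr_sqr.
  transitivity (\int[gamma]_x g (a * x)%R)%E.
    apply: eq_integral => x _.
    under eq_integral do rewrite mul0r addr0.
    exact: integral_prob_cst.
  have [a0|a0] := leP 0 a; first by rewrite ger0_norm.
  rewrite ltr0_norm// -ge0_integral_gammaN//.
  by apply: eq_integral => x _; rewrite mulrN mulNr.
set r := Num.sqrt _.
have r0 : 0 < r by rewrite sqrtr_gt0 ltr_wpDl ?sqr_ge0// exprn_gt0.
rewrite -(@normal_rotation_unit (a / r) (b / r) (fun u => g (r * u)))//; last 2 first.
- rewrite !expr_div_n -mulrDl sqr_sqrtr ?divff//.
    by rewrite gt_eqF// ltr_wpDl ?sqr_ge0// exprn_gt0.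
  by rewrite addr_ge0 ?sqr_ge0.
- by rewrite divr_gt0.
apply: eq_integral => x _; apply: eq_integral => y _; congr g.
by field; rewrite gt_eqF.
Qed.

(** Both branches of [gaussian_law] take the common form [m + r * N] with [N] standard normal; a
    point mass is the case [r = 0]. *)
Lemma gaussian_lawP d (T : measurableType d) (P : probability T R) (X : T -> R) :
  measurable_fun setT X -> gaussian_law (pushforward P X) ->
  exists m r : R, 0 <= r /\
    forall g : R -> \bar R, measurable_fun setT g -> (forall x, 0 <= g x)%E ->
    (\int[P]_w g (X w) = \int[gamma]_x g (m + r * x)%R)%E.
Proof.
move=> mX [m [s [s0 law]]]; exists m, s; split => // g mg g0.
rewrite -(@ge0_integral_image _ _ T (measurableTypeR R) R P X mX)//.
move: s0; rewrite le_eqVlt => /predU1P[s0|s0].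
  rewrite -s0 eqxx in law *.
  under [RHS]eq_integral do rewrite mul0r addr0.
  rewrite integral_prob_cst.
  rewrite (eq_measure_integral (@dirac _ (measurableTypeR R) m R : {measure set (measurableTypeR R) -> \bar R})); last first.
    by move=> A mA _; exact: law.
  by rewrite integral_dirac// diracT mul1e.
transitivity (\int[normal_prob m s]_x g x)%E.
  apply: eq_measure_integral => A mA _.
  by have := law A mA; rewrite gt_eqF.
rewrite (ge0_integral_normal_prob _ _ mg g0).
rewrite (ge0_integral_normal_prob 0 1 (measurable_comp_affine m s mg)); last by [].
rewrite (ge0_integral_affine m s0); last 2 first.
- by apply: emeasurable_funM => //; exact: measurable_phi.
- by move=> x; rewrite mule_ge0// lee_fin normal_pdf_ge0.
rewrite -ge0_integralZl//; last 3 first.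
- apply: (measurable_comp_affine (g := fun x => (g x * (normal_pdf m s x)%:E)%E)).
  by apply: emeasurable_funM => //; exact: measurable_phi.
- by move=> x _; rewrite mule_ge0// lee_fin normal_pdf_ge0.
- by rewrite lee_fin ltW.
apply: eq_integral => x _; rewrite muleCA; congr (_ * _)%E; rewrite -EFinM; congr EFin.
rewrite std_normal_pdfE -(normal_peak_scale s0) normal_pdfE ?gt_eqF// -mulrA.
congr (_ * (_ * expR _)); field; rewrite gt_eqF//.
Qed.

End standard_normal.

(** * Laws on tuples are determined by the laws of linear combinations *)

Section sign_approximation.
Context (R : realType).
Implicit Types y : R.

(** This cubic fixes [-1], [0] and [1], with slope [3 / 2] at [0] and slope [0] at the other two.
    Its iterates therefore push [[-1, 1]] minus the origin to the sign, and being polynomial they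
    stay inside an algebra of functions. *)
Definition smooth_sign y := (3 * y - y ^+ 3) / 2.

Lemma smooth_signN y : smooth_sign (- y) = - smooth_sign y.
Proof. by rewrite /smooth_sign exprNn -signr_odd/=; field. Qed.

Lemma iter_smooth_signN k y : iter k smooth_sign (- y) = - iter k smooth_sign y.
Proof. by elim: k => //= k ->; rewrite smooth_signN. Qed.

Lemma iter_smooth_sign_itv k y : 0 <= y <= 1 -> y <= iter k smooth_sign y <= 1.
Proof.
move=> /andP[y0 y1]; elim: k => /= [|k]; first by rewrite lexx.
set z := iter _ _ _ => /andP[yz z1]; have z0 := le_trans y0 yz.
rewrite /smooth_sign; apply/andP; split.
  apply: le_trans yz _; rewrite -subr_ge0.
  have -> : (3 * z - z ^+ 3) / 2 - z = z * (1 - z) * (1 + z) / 2 by field.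
  by rewrite divr_ge0// !mulr_ge0 ?subr_ge0 ?addr_ge0.
rewrite -subr_ge0.
have -> : 1 - (3 * z - z ^+ 3) / 2 = (1 - z) ^+ 2 * (2 + z) / 2 by field.
by rewrite divr_ge0// mulr_ge0 ?sqr_ge0 ?addr_ge0.
Qed.

(** One iteration multiplies the distance [1 - z] to the fixed point by [1 - z * (1 + z) / 2], which
    is at most [1 - y / 2] since the iterates never fall below [y]. *)
Lemma iter_smooth_sign_near k y : 0 <= y <= 1 ->
  1 - iter k smooth_sign y <= (1 - y / 2) ^+ k.
Proof.
move=> y01; elim: k => /= [|k IH]; first by case/andP: y01 => *; rewrite expr0; lra.
have /andP[] := iter_smooth_sign_itv k y01; move: IH.
set z := iter _ _ _ => IH yz z1; case/andP: y01 => y0 y1.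
have -> : 1 - smooth_sign z = (1 - z) * (1 - z / 2 * (1 + z)).
  by rewrite /smooth_sign; field.
rewrite exprSr ler_pM//; [lra| |nra].
nra.
Qed.

Lemma iter_smooth_sign_le1 k y : `|y| <= 1 -> `|iter k smooth_sign y| <= 1.
Proof.
wlog y0 : y / 0 <= y => [H y1|].
  have [/H->//|/ltW y0] := leP 0 y.
  by rewrite -[y]opprK iter_smooth_signN normrN H ?oppr_ge0// normrN.
rewrite ger0_norm// => y1.
have /andP[yz z1] := @iter_smooth_sign_itv k y (introT andP (conj y0 y1)).
by rewrite ger0_norm// (le_trans y0).
Qed.

Lemma cvg_iter_smooth_sign y : `|y| <= 1 -> iter k smooth_sign y @[k --> \oo] --> Num.sg y.
Proof.
move=> y1; wlog y0 : y y1 / 0 < y => [H|].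
  have [y0|y0|->] := ltrgt0P y.
  - by apply: H; rewrite ?y1.
  - rewrite -[y]opprK sgrN; under eq_fun do rewrite iter_smooth_signN.
    by apply: cvgN; apply: H; rewrite ?normrN ?oppr_gt0.
  - rewrite sgr0 (_ : (fun _ => _) = cst 0); first exact: cvg_cst.
    apply/funext => k /=; elim: k => //= k ->.
    by rewrite /smooth_sign expr0n/= mulr0 subr0 mul0r.
have y01 : 0 <= y <= 1 by rewrite ltW//= (le_trans (ler_norm _)).
rewrite gtr0_sg//; apply/cvgrPdist_le => e e0.
have : (1 - y / 2) ^+ k @[k --> \oo] --> (0 : R).
  by apply: cvg_expr; rewrite ger0_norm; case/andP: y01 => *; lra.
move=> /cvgrPdist_le/(_ _ e0); apply: filterS => k.
rewrite sub0r normrN => ek.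
have /andP[_ z1] := iter_smooth_sign_itv k y01.
rewrite ger0_norm ?subr_ge0// (le_trans (iter_smooth_sign_near k y01))//.
exact: le_trans (ler_norm _) ek.
Qed.

End sign_approximation.

Section bounded_measurable.
Context (R : realType) (d : measure_display) (T : measurableType d).
Implicit Types f g : T -> R.

Definition bounded_mfun g := measurable_fun setT g /\ exists M, forall x, `|g x| <= M.

Lemma bounded_mfun_integrable (P : probability T R) g :
  bounded_mfun g -> P.-integrable setT (EFin \o g).
Proof.
move=> [mg [M gM]]; apply: measurable_bounded_integrable => //.
  by rewrite [X in (X < _)%E](@probability_setT _ _ _ P) ltry.
exists M; split; first exact: num_real.
by move=> z Mz x _; apply: le_trans (gM x) (ltW Mz).
Qed.

Lemma bounded_mfunM f g : bounded_mfun f -> bounded_mfun g -> bounded_mfun (f \* g).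
Proof.
move=> [mf [M fM]] [mg [N gN]]; split; first exact: measurable_funM.
by exists (M * N) => x; rewrite normrM ler_pM.
Qed.

Lemma bounded_mfunD f g : bounded_mfun f -> bounded_mfun g -> bounded_mfun (f \+ g).
Proof.
move=> [mf [M fM]] [mg [N gN]]; split; first exact: measurable_funD.
by exists (M + N) => x; rewrite (le_trans (ler_normD _ _))// lerD.
Qed.

Lemma bounded_mfun_cst c : bounded_mfun (cst c).
Proof. by split => //; exists `|c|. Qed.

End bounded_measurable.

Section cramer_wold.
Context (R : realType) (n : nat) (mu nu : probability (n.-tuple R) R).
Implicit Types (a : 'I_n -> R) (x : n.-tuple R) (f g : n.-tuple R -> R).

Definition dot a x : R := \sum_(i < n) a i * tnth x i.

(** Equality of the Fourier transforms of the signed measures [f mu] and [f nu]; the phase [c]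
    covers the sine part as well as the cosine part. *)
Definition same_cos f := forall a c,
  \int[mu]_x (f x * cos (dot a x + c)) = \int[nu]_x (f x * cos (dot a x + c)).

(* Multipliers form an algebra containing the cosines and closed under bounded
   pointwise limits, hence containing the indicators of half-spaces: the sign of
   [sin (b * (x_i - c))] is the limit of the iterates of [smooth_sign], and agrees
   with that of [x_i - c] for small [b > 0]. *)
Definition multiplier g := bounded_mfun g /\
  forall f, bounded_mfun f -> same_cos f -> same_cos (f \* g).

Lemma measurable_dot a : measurable_fun setT (dot a).
Proof.
apply: measurable_sum => i; apply: measurable_funM => //; exact: measurable_tnth.
Qed.

Lemma bounded_mfun_cos a c : bounded_mfun (fun x => cos (dot a x + c)).
Proof.
split; last by exists 1 => x; exact: cos_max.
apply: (measurableT_comp (continuous_measurable_fun (@continuous_cos R))).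
by apply: measurable_funD => //; exact: measurable_dot.
Qed.

Lemma multiplier_cst c : multiplier (cst c).
Proof.
split; first exact: bounded_mfun_cst.
move=> f bf sf a e.
have E (P : probability (n.-tuple R) R) : \int[P]_x (f x * c * cos (dot a x + e)) =
    c * \int[P]_x (f x * cos (dot a x + e)) :> R.
  rewrite -RintegralZl//; first by apply: eq_Rintegral => x _; ring.
  by apply: bounded_mfun_integrable; apply: bounded_mfunM => //; exact: bounded_mfun_cos.
by rewrite /= !E sf.
Qed.

Lemma multiplierD g h : multiplier g -> multiplier h -> multiplier (g \+ h).
Proof.
move=> [bg sg] [bh sh]; split; first exact: bounded_mfunD.
move=> f bf sf a e.
have E (P : probability (n.-tuple R) R) : \int[P]_x (f x * (g x + h x) * cos (dot a x + e)) =
    \int[P]_x ((f \* g) x * cos (dot a x + e)) +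
    \int[P]_x ((f \* h) x * cos (dot a x + e)) :> R.
  rewrite -RintegralD//; first by apply: eq_Rintegral => x _ /=; ring.
  - by apply: bounded_mfun_integrable; apply: bounded_mfunM (bounded_mfun_cos _ _); exact: bounded_mfunM.
  - by apply: bounded_mfun_integrable; apply: bounded_mfunM (bounded_mfun_cos _ _); exact: bounded_mfunM.
by rewrite /= !E sg// sh.
Qed.

Lemma multiplierM g h : multiplier g -> multiplier h -> multiplier (g \* h).
Proof.
move=> [bg sg] [bh sh]; split; first exact: bounded_mfunM.
move=> f bf sf a e.
have -> : f \* (g \* h) = f \* g \* h by apply/funext => x /=; rewrite mulrA.
by apply: sh; [exact: bounded_mfunM|exact: sg].
Qed.

(** Product-to-sum formula: the extra cosine replaces the frequency [a] by [a - b] and [a + b],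
    where [same_cos f] applies again. *)
Lemma multiplier_cos b d : multiplier (fun x => cos (dot b x + d)).
Proof.
split; first exact: bounded_mfun_cos.
move=> f bf sf a e.
have E (P : probability (n.-tuple R) R) : \int[P]_x (f x * cos (dot b x + d) * cos (dot a x + e)) = 2^-1 *
    (\int[P]_x (f x * cos (dot (a \- b) x + (e - d))) +
    \int[P]_x (f x * cos (dot (a \+ b) x + (e + d)))) :> R.
  have bfc (u : 'I_n -> R) (v : R) : P.-integrable setT (EFin \o (fun x => f x * cos (dot u x + v))).
    by apply: bounded_mfun_integrable; apply: bounded_mfunM => //; exact: bounded_mfun_cos.
  rewrite -RintegralD// -RintegralZl//; last first.
    by apply: (integrableD _ (bfc _ _) (bfc _ _)).
  apply: eq_Rintegral => x _ /=.
  have -> : dot (a \- b) x + (e - d) = (dot a x + e) - (dot b x + d).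
    rewrite /dot; under eq_bigr do rewrite mulrBl.
    by rewrite sumrB; ring.
  have -> : dot (a \+ b) x + (e + d) = (dot a x + e) + (dot b x + d).
    rewrite /dot; under eq_bigr do rewrite mulrDl.
    by rewrite big_split/=; ring.
  by move: (dot a x + e) (dot b x + d) => A B; rewrite cosB cosD; field.
by rewrite /= !E !sf.
Qed.

Lemma multiplier_cvg (g_ : nat -> n.-tuple R -> R) g :
  (forall k, multiplier (g_ k)) -> (forall k x, `|g_ k x| <= 1) ->
  (forall x, g_ k x @[k --> \oo] --> g x) -> multiplier g.
Proof.
move=> mg g1 cg.
have gle1 x : `|g x| <= 1.
  by apply: (cvgr_to_le (cvg_norm (cg x))); apply: nearW => k; exact: g1.
have bg : bounded_mfun g.
  split; last by exists 1.
  apply: (measurable_fun_cvg (h := g_)) => // m.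
  by have [[]] := mg m.
split => // f bf sf a e.
have E (P : probability (n.-tuple R) R) :
    \int[P]_x (f x * g_ k x * cos (dot a x + e)) @[k --> \oo] -->
    \int[P]_x (f x * g x * cos (dot a x + e)).
  have bk k : bounded_mfun (fun x => f x * g_ k x * cos (dot a x + e)).
    by apply: bounded_mfunM (bounded_mfun_cos _ _); apply: bounded_mfunM => //; case: (mg k).
  have b : bounded_mfun (fun x => f x * g x * cos (dot a x + e)).
    by apply: bounded_mfunM (bounded_mfun_cos _ _); exact: bounded_mfunM.
  have [_ [M fM]] := bf.
  apply: fine_cvg; rewrite fineK; last exact: integrable_fin_num (bounded_mfun_integrable P b).
  have [] := @dominated_convergence _ _ _ P setT measurableT
    (fun k x => (f x * g_ k x * cos (dot a x + e))%:E)
    (fun x => (f x * g x * cos (dot a x + e))%:E) (cst M%:E) => //.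
  - by move=> k; apply/measurable_EFinP; case: (bk k).
  - by apply/measurable_EFinP; case: b.
  - apply: aeW => x _; apply: cvg_EFin; first exact: nearW.
    by apply: cvgMl; apply: cvgMr; exact: cg.
  - exact: (bounded_mfun_integrable P (bounded_mfun_cst _ M)).
  - apply: aeW => x k _ /=; rewrite lee_fin !normrM -[leRHS]mulr1 ler_pM//.
      by rewrite -[leRHS]mulr1 ler_pM.
    exact: cos_max.
apply: (cvg_unique _ (E mu)) => //.
rewrite (_ : (fun k => _) = fun k => \int[nu]_x (f x * g_ k x * cos (dot a x + e))).
  exact: E.
by apply/funext => k; exact: (proj2 (mg k) f bf sf a e).
Qed.

Lemma multiplier_sin (b c : R) i : multiplier (fun x => sin (b * (tnth x i - c))).
Proof.
pose e : 'I_n -> R := fun j => (j == i)%:R * b.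
have := multiplier_cos e (- b * c - pi / 2); congr multiplier.
apply/funext => x; rewrite addrA cosBpihalf; congr sin.
rewrite /dot (bigD1 i)//= /e eqxx mul1r big1 ?addr0; first by ring.
by move=> j /negbTE ->; rewrite !mul0r.
Qed.

Lemma multiplier_smooth_sign k g : multiplier g ->
  multiplier (fun x => iter k (@smooth_sign R) (g x)).
Proof.
move=> mg; elim: k => //= k; set h := fun x => _ => mh.
have -> : (fun x => smooth_sign (iter k (@smooth_sign R) (g x))) =
    (cst (3 / 2) \* h) \+ (cst (- 2^-1) \* (h \* (h \* h))).
  by apply/funext => x; rewrite /= /smooth_sign /h; field.
by apply: multiplierD; apply: multiplierM => //;
  [exact: multiplier_cst..|apply: multiplierM => //; exact: multiplierM].
Qed.

Lemma multiplier_sg_sin (b c : R) i :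
  multiplier (fun x => Num.sg (sin (b * (tnth x i - c)))).
Proof.
apply: (@multiplier_cvg
  (fun k x => iter k (@smooth_sign R) (sin (b * (tnth x i - c))))) => [k|k x|x].
- by apply: multiplier_smooth_sign; exact: multiplier_sin.
- by apply: iter_smooth_sign_le1; exact: sin_max.
- by apply: cvg_iter_smooth_sign; exact: sin_max.
Qed.

Lemma sg_le1 (y : R) : `|Num.sg y| <= 1.
Proof. by rewrite normr_sg; case: (y != 0). Qed.

Lemma sgr_sin (y : R) : `|y| < pi -> Num.sg (sin y) = Num.sg y.
Proof.
have [y0|y0|->] := ltrgt0P y; last by rewrite sin0.
- by move=> yp; rewrite !gtr0_sg//; apply: sin_gt0_pi; rewrite y0.
- move=> yp; rewrite !ltr0_sg// -oppr_gt0 -sinN.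
  by apply: sin_gt0_pi; rewrite oppr_gt0 y0.
Qed.

Lemma multiplier_sg (c : R) i : multiplier (fun x => Num.sg (tnth x i - c)).
Proof.
apply: (@multiplier_cvg
  (fun k x => Num.sg (sin (k.+1%:R^-1 * (tnth x i - c))))) => [k|k x|x].
- exact: multiplier_sg_sin.
- exact: sg_le1.
apply: cvg_near_cst; near=> k.
rewrite sgr_sin; first by rewrite sgrM gtr0_sg ?mul1r ?invr_gt0.
rewrite normrM gtr0_norm ?invr_gt0// mulrC ltr_pdivrMr//.
have xk : `|tnth x i - c| < k%:R by near: k; exact: nbhs_infty_gtr.
apply: (lt_le_trans xk); apply: (@le_trans _ _ (1 * k.+1%:R)).
  by rewrite mul1r ler_nat.
by rewrite ler_wpM2r// (le_trans _ (@pi_ge2 R))// ler1n.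
Unshelve. all: by end_near. Qed.

(** With the threshold exactly at [c], [(1 - sg) / 2] would take the value [1 / 2] on the boundary.
    Thresholds increasing to [c] from below give [0] there, hence the strict inequality in the
    limit. *)
Lemma multiplier_lt (c : R) i : multiplier (fun x => (tnth x i < c)%R%:R).
Proof.
apply: (@multiplier_cvg (fun k => (cst 2^-1 \+
    (cst (- 2^-1) \* (fun x => Num.sg (tnth x i - (c - k.+1%:R^-1))))))) => [k|k x|x].
- by apply: multiplierD (multiplierM _ _) => //; [exact: multiplier_cst..|exact: multiplier_sg].
- rewrite /= ler_norml mulNr; have := sg_le1 (tnth x i - (c - k.+1%:R^-1)).
  move: (Num.sg _) => s; rewrite ler_norml => /andP[s0 s1].
  have {}s0 : 0 <= 1 + s by rewrite addrC -lerBlDr sub0r.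
  by apply/andP; split; lra.
have k0 k : 0 < k.+1%:R^-1 :> R by rewrite invr_gt0.
have [xc|xc] := ltP (tnth x i) c; apply: cvg_near_cst; last first.
  apply: nearW => k /=; rewrite gtr0_sg; first by rewrite mulr1 subrr.
  by rewrite subr_gt0 (lt_le_trans _ xc)// ltrBlDr ltrDl.
have xc' : 0 < c - tnth x i by rewrite subr_gt0 xc.
have := near_infty_natSinv_lt (PosNum xc'); apply: filterS => k /= kx.
rewrite ltr0_sg; first by rewrite mulr1n; field.
by rewrite subr_lt0 ltrBrDr -ltrBrDl.
Qed.

Lemma multiplier_prod (h : 'I_n -> n.-tuple R -> R) (r : seq 'I_n) :
  (forall i, multiplier (h i)) -> multiplier (fun x => \prod_(i <- r) h i x).
Proof.
move=> mh; elim: r => [|i r IH].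
  rewrite (_ : (fun _ => _) = cst 1); first exact: multiplier_cst.
  by apply/funext => x; rewrite big_nil.
rewrite (_ : (fun _ => _) = h i \* (fun x => \prod_(j <- r) h j x)).
  exact: multiplierM.
by apply/funext => x; rewrite big_cons.
Qed.

Definition orthant (c : 'I_n -> R) := [set x : n.-tuple R | forall i, tnth x i < c i].

Lemma orthant_indic (c : 'I_n -> R) x :
  \prod_(i < n) (tnth x i < c i)%R%:R = \1_(orthant c) x :> R.
Proof.
rewrite indicE; have [/set_mem xc|xc] := boolP (x \in _).
  by rewrite big1// => i _; rewrite xc.
suff [i xi] : exists i, ~~ (tnth x i < c i) by rewrite (bigD1 i)//= (negbTE xi) mul0r.
apply/existsP; apply: contraR xc; rewrite negb_exists => /forallP xc.
by apply/mem_set => i; rewrite -[X in is_true X]negbK xc.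
Qed.

Lemma measurable_orthant c : measurable (orthant c).
Proof.
have -> : orthant c = \bigcap_(i in [set: 'I_n]) ((fun x => tnth x i) @^-1` `]-oo, c i[).
  apply/seteqP; split=> x /= H i; [move=> _|]; have := H i; rewrite /= in_itv//=.
  by move=> h; exact: (h I).
apply: fin_bigcap_measurable => // i _.
by rewrite -[X in measurable X]setTI; exact: measurable_tnth.
Qed.

Hypothesis same : forall a c, \int[mu]_x cos (dot a x + c) = \int[nu]_x cos (dot a x + c).

Lemma same_orthant c : mu (orthant c) = nu (orthant c).
Proof.
have [bh sh] := multiplier_prod (index_enum 'I_n) (fun i => multiplier_lt (c i) i).
have s1 : same_cos (cst 1).
  move=> a e; have := same a e.
  by under eq_Rintegral do rewrite -[cos _]mul1r;
     under [in RHS]eq_Rintegral do rewrite -[cos _]mul1r.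
(* At frequency 0 and phase 0 the cosine is 1, and equality of transforms becomes equality of the
   masses of the orthant. *)
have := sh _ (bounded_mfun_cst _ 1) s1 (fun=> 0) 0.
have E (P : probability (n.-tuple R) R) :
    \int[P]_x ((cst 1 \* (fun x => \prod_(i < n) (tnth x i < c i)%R%:R)) x *
      cos (dot (fun=> 0) x + 0)) = fine (P (orthant c)) :> R.
  rewrite -(setIT (orthant c)) -(integral_indic P measurableT (measurable_orthant c)).
  congr fine; apply: eq_integral => x _ /=.
  rewrite mul1r orthant_indic /dot big1 ?addr0 ?cos0 ?mulr1// => i _.
  by rewrite mul0r.
rewrite !E => munu; rewrite -[LHS]fineK ?fin_num_measure//; last exact: measurable_orthant.
by rewrite munu fineK ?fin_num_measure//; exact: measurable_orthant.
Qed.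

Definition orthants := [set A | exists c, A = orthant c].

Lemma measurable_orthants : measurable = <<s orthants >>.
Proof.
apply/seteqP; split; last first.
  apply: smallest_sub; first exact: sigma_algebra_measurable.
  by move=> _ [c ->]; exact: measurable_orthant.
suff mid : measurable_fun [set: g_sigma_algebraType orthants]
    (idfun : g_sigma_algebraType orthants -> n.-tuple R).
  by move=> A mA; have := mid measurableT A mA; rewrite setTI.
apply/measurable_fun_tnthP => i.
apply: (measurability _ (RGenInftyO.measurableE R)) => _ [_ [c ->]] <-.
rewrite setTI.
(* A half-space is the increasing union of the orthants whose other bounds are the integers [k]. *)
have -> : ((fun x : n.-tuple R => tnth x i) \o idfun) @^-1` `]-oo, c[ =
    \bigcup_k orthant (fun j => if j == i then c else k%:R).
  apply/seteqP; split => x /=; rewrite in_itv/=.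
    move=> xc; pose M := \sum_(j < n) `|tnth x j|.
    exists (Num.bound M) => // j; case: eqP => [->//|_].
    apply: le_lt_trans (archi_boundP _); last exact: sumr_ge0.
    by rewrite (le_trans (ler_norm _))// /M (bigD1 j)//= lerDl sumr_ge0.
  by move=> [k _ /(_ i)]; rewrite eqxx.
apply: bigcup_measurable => k _; apply: sub_sigma_algebra.
by eexists.
Qed.

Theorem cramer_wold A : measurable A -> mu A = nu A.
Proof.
pose g k : set (n.-tuple R) := orthant (fun=> k%:R).
apply: (measure_unique orthants g measurable_orthants) => //.
- move=> _ _ [c ->] [e ->]; exists (fun i => Num.min (c i) (e i)).
  apply/seteqP; split => x /=.
    by move=> [H K] i; rewrite lt_min H K.
  by move=> H; split=> i; have := H i; rewrite lt_min => /andP[].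
- by move=> k; eexists.
- rewrite -subTset => x _; pose M := \sum_(j < n) `|tnth x j|.
  exists (Num.bound M) => // j.
  apply: le_lt_trans (archi_boundP _); last exact: sumr_ge0.
  by rewrite (le_trans (ler_norm _))// /M (bigD1 j)//= lerDl sumr_ge0.
- by move=> _ [c ->]; exact: same_orthant.
- by move=> k; rewrite -ge0_fin_numE// fin_num_measure//; exact: measurable_orthant.
Qed.

End cramer_wold.

Section nonneg_cramer_wold.
Context (R : realType) (n : nat) (mu nu : probability (n.-tuple R) R).

Lemma ge0_cramer_wold :
  (forall (a : 'I_n -> R) c,
    \int[mu]_x (1 + cos (dot a x + c))%:E = \int[nu]_x (1 + cos (dot a x + c))%:E)%E ->
  forall A, measurable A -> mu A = nu A.
Proof.
move=> same; apply: cramer_wold => a c.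
have E (P : probability (n.-tuple R) R) :
    \int[P]_x cos (dot a x + c) =
    fine (\int[P]_x (1 + cos (dot a x + c))%:E)%E - 1 :> R.
  have b1 := bounded_mfun_integrable P (bounded_mfun_cst (n.-tuple R) (1 : R)).
  have bc := bounded_mfun_integrable P (bounded_mfun_cos a c).
  have I1 : \int[P]_x cst 1 x = 1 :> R by exact: (congr1 fine (integral_prob_cst P 1%:E)).
  have D := RintegralD measurableT b1 bc.
  by rewrite -[fine _]/(\int[P]_x (cst 1 x + cos (dot a x + c))) D I1 addrAC subrr add0r.
by rewrite !E same.
Qed.

End nonneg_cramer_wold.

(** * Resampling the process *)

Section hyperbolic.
Context (R : realType).
Implicit Types u v : R.

Definition tanh u := (expR u - expR (- u)) / (expR u + expR (- u)).

Lemma expRDN_gt0 u : 0 < expR u + expR (- u).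
Proof. by rewrite addr_gt0 ?expR_gt0. Qed.

Lemma sech_gt0 u : 0 < sech u.
Proof. by rewrite divr_gt0 ?expRDN_gt0. Qed.

Lemma sech0 : sech 0 = 1 :> R.
Proof. by rewrite /sech oppr0 expR0 -natr1 divff// gt_eqF. Qed.

Lemma sechN u : sech (- u) = sech u.
Proof. by rewrite /sech opprK addrC. Qed.

Lemma tanh0 : tanh 0 = 0.
Proof. by rewrite /tanh oppr0 subrr mul0r. Qed.

Lemma tanh_gt0 u : 0 < u -> 0 < tanh u.
Proof.
by move=> u0; rewrite divr_gt0 ?expRDN_gt0// subr_gt0 ltr_expR; lra.
Qed.

Lemma tanh_ge0 u : 0 <= u -> 0 <= tanh u.
Proof. by rewrite le_eqVlt => /predU1P[<-|/tanh_gt0/ltW//]; rewrite tanh0. Qed.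

(* [cosh (v - u) = cosh u * cosh v - sinh u * sinh v], divided by the three
   hyperbolic cosines. *)
Lemma sech_tanh u v : sech u * sech v + tanh u * tanh v * sech (v - u) = sech (v - u).
Proof.
have e0 (w : R) : expR w != 0 by rewrite gt_eqF ?expR_gt0.
have e2 (w : R) : expR w ^+ 2 + 1 != 0 by rewrite gt_eqF// ltr_wpDl ?sqr_ge0.
have euv : expR u ^+ 2 + expR v ^+ 2 != 0.
  by rewrite gt_eqF// addr_gt0 ?exprn_gt0 ?expR_gt0.
have evu : expR v ^+ 2 + expR u ^+ 2 != 0 by rewrite addrC.
have sE (w : R) : sech w = 2 * expR w / (expR w ^+ 2 + 1).
  by rewrite /sech expRN; field; rewrite ?e0 ?e2.
have tE (w : R) : tanh w = (expR w ^+ 2 - 1) / (expR w ^+ 2 + 1).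
  by rewrite /tanh expRN; field; rewrite ?e0 ?e2.
have -> : sech (v - u) = 2 * expR u * expR v / (expR u ^+ 2 + expR v ^+ 2).
  by rewrite sE expRD expRN; field; rewrite ?e0 ?e2 ?euv ?evu.
by rewrite !sE !tE; field; rewrite ?e0 ?e2 ?euv ?evu.
Qed.

End hyperbolic.

Section sech_process.
Context (R : realType) (d : measure_display) (Omega : measurableType d)
  (P : probability Omega R) (Y : R -> {RV P >-> R}).
Hypothesis hY : sech_gaussian_process Y.
Notation gamma := (normal_prob 0 1 : probability _ R).

Lemma measurable_process t : measurable_fun setT (Y t : Omega -> R).
Proof. exact: measurable_funP. Qed.

Lemma process_sqr t : (\int[P]_w (Y t w ^+ 2)%:E = 1)%E.
Proof.
have [_ _ _ _ /(_ t t)] := hY; rewrite unlock subrr mul0r sech0 => <-.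
by apply: eq_integral => w _; rewrite expr2.
Qed.

Lemma process_sqr_integrable t : P.-integrable setT (fun w => (Y t w ^+ 2)%:E).
Proof.
apply/integrableP; split.
  by apply/measurable_EFinP; apply: measurable_funX; exact: measurable_process.
under eq_integral do rewrite gee0_abs ?lee_fin ?sqr_ge0//.
by rewrite process_sqr ltry.
Qed.

Lemma process_integrable t : P.-integrable setT (fun w => (Y t w)%:E).
Proof.
apply: (le_integrable _ _ _ (integrableD _
    (finite_measure_integrable_cst P 1 measurableT) (process_sqr_integrable t))) => //.
  by apply/measurable_EFinP; exact: measurable_process.
move=> w _ /=; rewrite lee_fin [leRHS]ger0_norm ?addr_ge0 ?sqr_ge0//.
by rewrite -[X in _ + X]real_normK ?num_real//; set y := `|_|; nra.
Qed.

Lemma process_mul_integrable s t : P.-integrable setT (fun w => (Y s w * Y t w)%:E).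
Proof.
apply: (le_integrable _ _ _ (integrableD _
    (process_sqr_integrable s) (process_sqr_integrable t))) => //.
  by apply/measurable_EFinP; apply: measurable_funM; exact: measurable_process.
move=> w _ /=; rewrite lee_fin [leRHS]ger0_norm ?addr_ge0 ?sqr_ge0//.
rewrite normrM -[X in X + _]real_normK ?num_real// -[X in _ + X]real_normK ?num_real//.
have := sqr_ge0 (`|Y s w| - `|Y t w|); have := normr_ge0 (Y s w).
have := normr_ge0 (Y t w); nra.
Qed.

(** Variance of [\sum_i a i * Y (t i)]. Times form a sequence over [nat], so that dropping the first
    one is composition with [succn]. *)
Definition covq n (t : nat -> R) (a : 'I_n -> R) : R :=
  \sum_(i < n) \sum_(j < n) a i * a j * sech ((t j - t i) / 2).

(** The free constant [c] separates mean from variance: comparing two values of [c] reveals the mean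
    of the combination. *)
Lemma process_second_moment n (t : nat -> R) (a : 'I_n -> R) c :
  (\int[P]_w ((\sum_(i < n) a i * Y (t i) w + c) ^+ 2)%:E = (covq t a + c ^+ 2)%:E)%E.
Proof.
have icov i j : (\int[P]_w (Y (t i) w * Y (t j) w)%:E = (sech ((t j - t i) / 2))%:E)%E.
  by have [_ _ _ _ /(_ (t i) (t j))] := hY; rewrite unlock.
have ic i : (\int[P]_w (Y (t i) w)%:E = 0)%E.
  by have [_ /(_ (t i)) + _ _ _] := hY; rewrite unlock.
transitivity (\int[P]_w (\sum_(i < n) \sum_(j < n)
    (a i * a j)%:E * (Y (t i) w * Y (t j) w)%:E +
  (\sum_(i < n) (2 * c * a i)%:E * (Y (t i) w)%:E + (c ^+ 2)%:E)))%E.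
  apply: eq_integral => w _.
  rewrite sqrrD expr2 mulr_suml -addrA EFinD; congr (_ + _)%E.
    rewrite -sumEFin; apply: eq_bigr => i _.
    rewrite mulr_sumr -sumEFin; apply: eq_bigr => j _.
    by rewrite -EFinM; congr EFin; ring.
  rewrite EFinD; congr (_ + _)%E.
  rewrite -mulrnAr mulr_suml -sumEFin.
  by apply: eq_bigr => i _; rewrite -EFinM; congr EFin; ring.
have i1 (i : 'I_n) : P.-integrable setT (fun w => (2 * c * a i)%:E * (Y (t i) w)%:E)%E.
  by apply: integrableZl => //; exact: process_integrable.
have i2 (i j : 'I_n) :
    P.-integrable setT (fun w => (a i * a j)%:E * (Y (t i) w * Y (t j) w)%:E)%E.
  by apply: integrableZl => //; exact: process_mul_integrable.
have i2s (i : 'I_n) : P.-integrable setT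
    (fun w => \sum_(j < n) (a i * a j)%:E * (Y (t i) w * Y (t j) w)%:E)%E.
  by apply: integrable_sum => // j _; exact: i2.
rewrite integralD//; last 2 first.
- by apply: integrable_sum => // i _; exact: i2s.
- apply: integrableD => //; first by apply: integrable_sum => // i _; exact: i1.
  exact: finite_measure_integrable_cst.
rewrite integralD//; last 2 first.
- by apply: integrable_sum => // i _; exact: i1.
- exact: finite_measure_integrable_cst.
rewrite integral_prob_cst !integral_sum//.
rewrite [X in (_ + (X + _))%E]big1 ?add0e; last first.
  by move=> i _; rewrite integralZl ?ic ?mule0//; exact: process_integrable.
rewrite EFinD; congr (_ + _)%E.
rewrite /covq -sumEFin; apply: eq_bigr => i _.
rewrite integral_sum// -sumEFin; apply: eq_bigr => j _.
by rewrite integralZl//; [rewrite icov|exact: process_mul_integrable].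
Qed.

Lemma measurable_combination n (t : nat -> R) (a : 'I_n -> R) :
  measurable_fun setT (fun w => \sum_(i < n) a i * Y (t i) w).
Proof.
by apply: measurable_sum => i; apply: measurable_funM => //; exact: measurable_process.
Qed.

Definition gamma2 : \bar R := (\int[gamma]_x (x ^+ 2)%:E)%E.

(** Averaging the integrand over [x] and [- x] removes the cross term [2 * m * r * x] and keeps
    everything nonnegative; at this point [gamma2] might still be infinite. *)
Lemma gamma_second_moment (m r : R) :
  (\int[gamma]_x ((m + r * x) ^+ 2)%:E = (m ^+ 2)%:E + (r ^+ 2)%:E * gamma2)%E.
Proof.
have mg : measurable_fun setT (fun x : R => ((m + r * x) ^+ 2)%:E).
  by apply/measurable_EFinP/measurable_funX; exact: measurable_affine.
have mgN : measurable_fun setT (fun x : R => ((m + r * - x) ^+ 2)%:E).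
  exact: (measurableT_comp mg).
have mx2 : measurable_fun setT (fun x : R => (x ^+ 2)%:E).
  by apply/measurable_EFinP; exact: measurable_funX.
have h : (2%:E * \int[gamma]_x ((m + r * x) ^+ 2)%:E =
    2%:E * ((m ^+ 2)%:E + (r ^+ 2)%:E * gamma2))%E.
  transitivity (\int[gamma]_x (((m + r * x) ^+ 2)%:E + ((m + r * - x) ^+ 2)%:E))%E.
    rewrite ge0_integralD//; last 2 first.
    - by move=> x _; rewrite lee_fin sqr_ge0.
    - by move=> x _; rewrite lee_fin sqr_ge0.
    rewrite (@ge0_integral_gammaN _ (fun x => ((m + r * x) ^+ 2)%:E))//.
      by rewrite -mule2n mule_natl.
    by move=> x; rewrite lee_fin sqr_ge0.
  transitivity (\int[gamma]_x (2%:E * ((m ^+ 2)%:E + (r ^+ 2)%:E * (x ^+ 2)%:E)))%E.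
    by apply: eq_integral => x _; rewrite -EFinM -!EFinD -?EFinM; congr EFin; ring.
  have r2 : (0 <= (r ^+ 2)%:E)%E by rewrite lee_fin sqr_ge0.
  have m2 : (0 <= (m ^+ 2)%:E)%E by rewrite lee_fin sqr_ge0.
  have mr : measurable_fun setT (fun x : R => (r ^+ 2)%:E * (x ^+ 2)%:E)%E.
    exact: emeasurable_funM.
  rewrite ge0_integralZl//; last 2 first.
  - exact: emeasurable_funD.
  - by move=> x _; rewrite adde_ge0// mule_ge0// lee_fin sqr_ge0.
  congr (_ * _)%E; rewrite ge0_integralD//; last first.
    by move=> x _; rewrite mule_ge0// lee_fin sqr_ge0.
  rewrite integral_prob_cst ge0_integralZl//.
  by move=> x _; rewrite lee_fin sqr_ge0.
have := congr1 (fun u => (2^-1%:E * u)%E) h.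
by rewrite !(muleA 2^-1%:E) -EFinM mulVf// !mul1e.
Qed.

(** Each combination has law [r * N] with [r ^ 2 * gamma2] equal to its variance. The single value
    [Y 0], of variance 1, fixes the unit [r0], and every other [r] is [r0] times the square root of
    the variance. *)
Lemma process_scale : exists2 r0 : R, 0 < r0 &
  forall n (t : nat -> R) (a : 'I_n -> R) (g : R -> \bar R),
    measurable_fun setT g -> (forall x, 0 <= g x)%E ->
    (\int[P]_w g (\sum_(i < n) a i * Y (t i) w)%R =
     \int[gamma]_x g (r0 * Num.sqrt (covq t a) * x)%R)%E.
Proof.
have law n (t : nat -> R) (a : 'I_n -> R) : exists r : R, [/\ 0 <= r,
    (covq t a)%:E = ((r ^+ 2)%:E * gamma2)%E &
    forall g : R -> \bar R, measurable_fun setT g -> (forall x, 0 <= g x)%E ->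
    (\int[P]_w g (\sum_(i < n) a i * Y (t i) w)%R = \int[gamma]_x g (r * x)%R)%E].
  have [gY _ _ _ _] := hY.
  have [m [r [r0 H]]] := gaussian_lawP (measurable_combination t a) (gY n (fun i => t i) a).
  have H2 c : (covq t a + c ^+ 2)%:E = (((m + c) ^+ 2)%:E + (r ^+ 2)%:E * gamma2)%E.
    rewrite -process_second_moment -gamma_second_moment.
    rewrite (H (fun u => ((u + c) ^+ 2)%:E)).
    - by apply: eq_integral => x _; rewrite addrAC.
    - by apply/measurable_EFinP/measurable_funX; exact: measurable_funD.
    - by move=> x; rewrite lee_fin sqr_ge0.
  (* Subtracting the case [c = 0] from the case [c = 1] leaves [1 = 2 * m + 1]. *)
  have m0 : m = 0.
    have := H2 0; have := H2 1; case: ((r ^+ 2)%:E * gamma2)%E => //= v [h1] [h2].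
    by move: h1 h2; nra.
  exists r; split => //; first by have := H2 0; rewrite m0 addr0 expr0n/= addr0 add0e.
  by move=> g mg g0; rewrite H// m0; under eq_integral do rewrite add0r.
have [r0 [r0ge0 h0 _]] := law 1 (fun=> 0) (fun=> 1).
have c1 : covq (fun=> 0) (fun _ : 'I_1 => 1) = 1.
  by rewrite /covq !big_ord1 subrr mul0r sech0 !mulr1.
rewrite c1 in h0.
have r0gt0 : 0 < r0.
  rewrite lt_neqAle r0ge0 andbT eq_sym; apply: contra_eq_neq h0 => ->.
  by rewrite expr0n mul0e eqe oner_eq0.
exists r0 => // n t a g mg g0.
have [r [rge0 h ->//]] := law n t a.
(* [gamma2] is finite: otherwise the variance 1 of [Y 0] would equal [r0 ^ 2] times infinity. *)
have [v hv] : exists v : R, gamma2 = v%:E.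
  have : (0 <= gamma2)%E by apply: integral_ge0 => x _; rewrite lee_fin sqr_ge0.
  case: gamma2 h0 => [v _ _| |//]; first by exists v.
  by rewrite gt0_muley// lte_fin exprn_gt0.
move: h0 h; rewrite hv -!EFinM => -[h0] [h].
have -> : covq t a = (r / r0) ^+ 2.
  rewrite h expr_div_n; have -> : v = (r0 ^+ 2)^-1; last by [].
  by apply: (mulfI (x := r0 ^+ 2)); rewrite ?expf_neq0 ?gt_eqF// -h0 divff// expf_neq0 ?gt_eqF.
rewrite sqrtr_sqr ger0_norm ?divr_ge0// mulrC divfK ?gt_eqF//.
Qed.

End sech_process.

Section decomposition.
Context (R : realType) (d : measure_display) (Omega : measurableType d)
  (P : probability Omega R) (Y : R -> {RV P >-> R}).
Notation gamma := (normal_prob 0 1 : probability _ R).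

(* The scale [r] is the standard deviation of [Y t], that is [1]; carrying it as an
   unknown avoids computing the second moment of the standard normal law. *)
Definition process_law (r : R) :=
  0 < r /\ forall n (t : nat -> R) (a : 'I_n -> R) (g : R -> \bar R),
    measurable_fun setT g -> (forall x, 0 <= g x)%E ->
    (\int[P]_w g (\sum_(i < n) a i * Y (t i) w)%R =
     \int[gamma]_x g (r * Num.sqrt (covq t a) * x)%R)%E.

Context (r : R) (hr : process_law r).

Definition sample n (t : nat -> R) (w : Omega) : n.-tuple R :=
  [tuple Y (t i) w | i < n].

Definition resample s n (t : nat -> R) (z : R) (w : Omega) : n.-tuple R :=
  [tuple sech ((t i - s) / 2) * z + tanh ((t i - s) / 2) * Y (t i) w | i < n].

Lemma measurable_sample n t : measurable_fun setT (@sample n t).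
Proof.
apply/measurable_fun_tnthP => i.
rewrite (_ : _ \o _ = Y (t i)); first exact: measurable_process.
by apply/funext => w /=; rewrite tnth_mktuple.
Qed.

Lemma measurable_resample2 s n t :
  measurable_fun setT (fun zw : measurableTypeR R * Omega => @resample s n t (r * zw.1) zw.2).
Proof.
apply/measurable_fun_tnthP => i.
rewrite (_ : _ \o _ = fun zw : measurableTypeR R * Omega => sech ((t i - s) / 2) * (r * zw.1) +
    tanh ((t i - s) / 2) * Y (t i) zw.2); last first.
  by apply/funext => w /=; rewrite tnth_mktuple.
apply: measurable_funD; apply: measurable_funM => //; first exact: measurable_funM.
exact: (measurableT_comp (measurable_process Y (t i))).
Qed.

Lemma measurable_resample s n t z : measurable_fun setT (@resample s n t z).
Proof.
apply/measurable_fun_tnthP => i.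
rewrite (_ : _ \o _ = fun w : Omega => sech ((t i - s) / 2) * z +
    tanh ((t i - s) / 2) * Y (t i) w); last first.
  by apply/funext => w /=; rewrite tnth_mktuple.
by apply: measurable_funD => //; apply: measurable_funM.
Qed.

(** This is [sech_tanh] summed against [a i * a j]: the value at [s] and the independent copy
    contribute the two summands of the variance. *)
Lemma covq_split s n (t : nat -> R) (a : 'I_n -> R) :
  (\sum_(i < n) a i * sech ((t i - s) / 2)) ^+ 2 +
  covq t (fun i => a i * tanh ((t i - s) / 2)) = covq t a.
Proof.
rewrite expr2 mulr_suml /covq -big_split/=; apply: eq_bigr => i _.
rewrite mulr_sumr -big_split/=; apply: eq_bigr => j _.
have -> : (t j - t i) / 2 = (t j - s) / 2 - (t i - s) / 2 by ring.
rewrite -[in RHS]sech_tanh; ring.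
Qed.

Lemma covq_ge0 n (t : nat -> R) (a : 'I_n -> R) : sech_gaussian_process Y -> 0 <= covq t a.
Proof.
move=> hY; have := process_second_moment hY t a 0.
rewrite expr0n addr0 => E; rewrite -lee_fin -E.
by apply: integral_ge0 => w _; rewrite lee_fin sqr_ge0.
Qed.

(* Conditionally on its value [z] at time [s], the process is
   [sech * z + tanh * Y'] with [Y'] distributed as [Y] itself. *)
Theorem ge0_expectation_resample s n (t : nat -> R) (F : n.-tuple R -> \bar R) :
  sech_gaussian_process Y -> measurable_fun setT F -> (forall v, 0 <= F v)%E ->
  (\int[P]_w F (sample n t w) =
   \int[gamma]_z \int[P]_w F (resample s n t (r * z) w))%E.
Proof.
move=> hY mF F0; have [r0 law] := hr.
pose V : {mfun Omega >-> n.-tuple R} := mfun_Sub (mem_set (measurable_sample (n := n) t)).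
pose W : {mfun (measurableTypeR R * Omega)%type >-> n.-tuple R} :=
  mfun_Sub (mem_set (measurable_resample2 s (n := n) t)).
have mFW : measurable_fun setT (fun zw : measurableTypeR R * Omega => F (W zw)).
  exact: (measurableT_comp mF (measurable_resample2 s (n := n) t)).
have toW (G : n.-tuple R -> \bar R) : measurable_fun setT G -> (forall v, 0 <= G v)%E ->
    (\int[distribution (gamma \x P)%E W]_v G v =
     \int[gamma]_z \int[P]_w G (resample s n t (r * z) w))%E.
  move=> mG G0; rewrite ge0_integral_pushforward//.
  rewrite fubini_tonelli1//; last by move=> x; exact: G0.
  exact: (measurableT_comp mG (measurable_resample2 s (n := n) t)).
transitivity (\int[distribution P V]_v F v)%E.
  by rewrite ge0_integral_pushforward.
rewrite -toW//; apply: eq_measure_integral => A mA _.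
apply: ge0_cramer_wold mA => a c.
have mcos (u : R) : measurable_fun setT (fun x : R => (1 + cos (u + x + c))%:E).
  apply/measurable_EFinP; apply: measurable_funD => //.
  apply: (measurableT_comp (continuous_measurable_fun (@continuous_cos R))).
  by apply: measurable_funD => //; apply: measurable_funD.
have cos0 (u : R) : (0 <= (1 + cos u)%:E)%E.
  by rewrite lee_fin; have := cos_max u; rewrite ler_norml => /andP[? _]; lra.
have mdc : measurable_fun setT (fun x : n.-tuple R => (1 + cos (dot a x + c))%:E).
  apply/measurable_EFinP; apply: measurable_funD => //.
  apply: (measurableT_comp (continuous_measurable_fun (@continuous_cos R))).
  by apply: measurable_funD => //; exact: measurable_dot.
rewrite toW//.
transitivity (\int[P]_w (1 + cos (0 + \sum_(i < n) a i * Y (t i) w + c))%:E)%E.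
  rewrite ge0_integral_pushforward//; apply: eq_integral => w _ /=.
  by rewrite add0r; congr (1 + cos (_ + _))%:E; apply: eq_bigr => i _; rewrite tnth_mktuple.
rewrite (law n t a (fun x => (1 + cos (0 + x + c))%:E))//.
pose al := \sum_(i < n) a i * sech ((t i - s) / 2).
pose b := fun i : 'I_n => a i * tanh ((t i - s) / 2).
(* For fixed [z] the resampled combination is [al * r * z] plus a centered normal variable.
   [normal_rotation] merges the two normal variables, and [covq_split] identifies the resulting
   standard deviation. *)
transitivity (\int[gamma]_z \int[gamma]_x
    (1 + cos (0 + (al * r * z + r * Num.sqrt (covq t b) * x) + c))%:E)%E; last first.
  apply: eq_integral => z _.
  under eq_integral do rewrite add0r.
  rewrite -(law n t b (fun x => (1 + cos (al * r * z + x + c))%:E))//.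
  apply: eq_integral => w _; congr (1 + cos (_ + _))%:E.
  rewrite /dot /al /b !mulr_suml -big_split/=; apply: eq_bigr => i _.
  by rewrite tnth_mktuple; ring.
rewrite (normal_rotation _ _ (g := fun x => (1 + cos (0 + x + c))%:E))//.
apply: eq_integral => x _; congr (1 + cos (_ + _ * _ + _))%:E.
rewrite !exprMn sqr_sqrtr ?covq_ge0// [al ^+ 2 * _]mulrC -mulrDr.
by rewrite sqrtrM ?sqr_ge0// sqrtr_sqr gtr0_norm// covq_split.
Qed.

End decomposition.

(** * Association *)

Section association.
Context (R : realType).

(* With [m] the mean of [G] and [k] a value of [F] at the point where [G] crosses
   [m], the product [(F - k) * (G - m)] is nonnegative everywhere. *)
Lemma nonincreasing_correlation (mu : probability (measurableTypeR R) R)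
    (F G : R -> R) : bounded_mfun (F : measurableTypeR R -> R) ->
  bounded_mfun (G : measurableTypeR R -> R) ->
  (forall x, 0 <= F x) ->
  {homo F : x y /~ x <= y} -> {homo G : x y /~ x <= y} ->
  (\int[mu]_x F x) * (\int[mu]_x G x) <= \int[mu]_x (F x * G x).
Proof.
move=> bF bG F0 dF dG; set m := \int[mu]_x G x.
have [k hk] : exists k, forall x, 0 <= (F x - k) * (G x - m).
  (* [G] may jump over its mean [m], so [k] is the supremum of [F] where [G < m]. By monotonicity
     those points lie to the right of the others, hence [F >= k] wherever [G >= m]. If there are
     none, [k = 0] works because [F] is nonnegative. *)
  pose S := [set F x | x in [set x | G x < m]].
  have [[z Sz]|Sn] := pselect (S !=set0); last first.
    exists 0 => x; rewrite subr0 mulr_ge0// subr_ge0 leNgt.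
    by apply/negP => Gx; apply: Sn; exists (F x), x.
  exists (sup S) => x; have [Gx|Gx] := leP m (G x).
    apply: mulr_ge0; rewrite subr_ge0//.
    apply: ge_sup; first by exists z.
    move=> _ [y /= Gy <-]; apply: dF; rewrite leNgt; apply/negP => xy.
    by have := dG _ _ (ltW xy); rewrite leNgt (lt_le_trans Gy).
  rewrite nmulr_lge0 ?subr_lt0// subr_le0.
  apply: ub_le_sup; last by exists x.
  have [_ [M FM]] := bF; exists M => _ [y _ <-].
  exact: le_trans (ler_norm _) (FM y).
have bFG := bounded_mfunM bF bG.
have bc (c : R) := bounded_mfun_cst (measurableTypeR R) c.
have bH : bounded_mfun (fun x : measurableTypeR R => (F x - k) * (G x - m)).
  by apply: bounded_mfunM (bounded_mfunD bF (bc (- k))) (bounded_mfunD bG (bc (- m))).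
have iF := bounded_mfun_integrable mu bF.
have iG := bounded_mfun_integrable mu bG.
have iFG := bounded_mfun_integrable mu bFG.
have icst c : \int[mu]_x (cst c x : R) = c.
  exact: (congr1 fine (integral_prob_cst mu c%:E)).
have : \int[mu]_x ((F x - k) * (G x - m)) =
    \int[mu]_x (F x * G x) - (\int[mu]_x F x) * m.
  transitivity (\int[mu]_x ((F x * G x + - m * F x) + (- k * G x + cst (k * m) x))).
    by apply: eq_Rintegral => x _ /=; ring.
  have bmF := bounded_mfunM (bc (- m)) bF.
  have bkG := bounded_mfunM (bc (- k)) bG.
  rewrite RintegralD//; [|exact: bounded_mfun_integrable (bounded_mfunD bFG bmF)
    |exact: bounded_mfun_integrable (bounded_mfunD bkG (bc _))].
  rewrite RintegralD//; [|exact: bounded_mfun_integrable bmF].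
  rewrite RintegralD//; [|exact: bounded_mfun_integrable bkG
    |exact: bounded_mfun_integrable (bc _)].
  by rewrite icst !RintegralZl// -/m; ring.
move=> E; rewrite -subr_ge0 -E.
by apply: Rintegral_ge0 => x _; exact: hk.
Qed.

End association.

Section process_association.
Context (R : realType) (d : measure_display) (Omega : measurableType d)
  (P : probability Omega R) (Y : R -> {RV P >-> R}).
Hypothesis hY : sech_gaussian_process Y.
Context (r : R) (hr : process_law Y r).
Notation gamma := (normal_prob 0 1 : probability _ R).

Lemma measurable_prob_resample s n (t : nat -> R) (A : set (n.-tuple R)) :
  measurable A ->
  measurable_fun setT (fun z : measurableTypeR R => P (resample Y s n t (r * z) @^-1` A)).
Proof.
move=> mA.
pose E := (fun zw : measurableTypeR R * Omega => resample Y s n t (r * zw.1) zw.2) @^-1` A.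
have mE : measurable E.
  by rewrite -[E]setTI; exact: (measurable_resample2 Y r s (n := n) t).
have := measurable_fun_xsection P mE; congr measurable_fun.
apply/funext => z /=; congr (P _); apply/seteqP; split => w /=.
  by rewrite /xsection/= inE.
by rewrite /xsection/= inE.
Qed.

Lemma probability_sample s n (t : nat -> R) (A : set (n.-tuple R)) : measurable A ->
  P (sample Y n t @^-1` A) = (\int[gamma]_z P (resample Y s n t (r * z) @^-1` A))%E.
Proof.
move=> mA.
have mp (f : Omega -> n.-tuple R) : measurable_fun setT f -> measurable (f @^-1` A).
  by move=> mf; rewrite -[X in measurable X]setTI; exact: mf.
have := ge0_expectation_resample hr s t (F := fun v => (\1_A v)%:E) hY.
rewrite (_ : (\int[P]_w _)%E = P (sample Y n t @^-1` A)); last first.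
  rewrite -(setIT (sample Y n t @^-1` A)) -(integral_indic P measurableT)//.
  exact: mp (measurable_sample _ _).
move=> ->.
- apply: eq_integral => z _.
  rewrite -(setIT (_ @^-1` A)) -(integral_indic P measurableT)//.
  exact: mp (measurable_resample _ _ _ _).
- by apply/measurable_EFinP; exact: measurable_indic.
- by move=> v; rewrite lee_fin.
Qed.

Definition lower n (A : set (n.-tuple R)) :=
  forall u v, (forall i, tnth v i <= tnth u i) -> A u -> A v.

(** Resampling at the first time leaves [n] random coordinates, which is what makes an induction on
    the number of times possible. The [0] put in front of [v] is a placeholder: its coefficient is
    [tanh 0 = 0], and entry 0 is [z]. *)
Definition mix n (t : nat -> R) (z : R) (v : n.-tuple R) : n.+1.-tuple R :=
  [tuple sech ((t i - t 0) / 2) * z + tanh ((t i - t 0) / 2) * nth 0 (0 :: v) i | i < n.+1].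

Lemma resample_mix n (t : nat -> R) z w :
  resample Y (t 0) n.+1 t z w = mix t z (sample Y n (t \o succn) w).
Proof.
apply: eq_mktuple => i; congr (_ + _); case: i => -[|i] ilt /=.
  by rewrite subrr mul0r tanh0 !mul0r.
have ilt' : (i < n)%N by [].
have := tnth_nth 0 (sample Y n (t \o succn) w) (Ordinal ilt').
by rewrite tnth_mktuple/= => ->.
Qed.

Lemma measurable_mix n (t : nat -> R) z : measurable_fun setT (@mix n t z).
Proof.
apply/measurable_fun_tnthP => -[[|i] ilt].
  rewrite (_ : _ \o _ = cst z); first exact: measurable_cst.
  by apply/funext => v; rewrite /= tnth_mktuple/= subrr mul0r sech0 tanh0 mul0r addr0 mul1r.
have ilt' : (i < n)%N by [].
rewrite (_ : _ \o _ = fun v : n.-tuple R => sech ((t i.+1 - t 0) / 2) * z +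
    tanh ((t i.+1 - t 0) / 2) * tnth v (Ordinal ilt')); last first.
  by apply/funext => v; rewrite /= tnth_mktuple/= (tnth_nth 0).
by apply: measurable_funD => //; apply: measurable_funM => //; exact: measurable_tnth.
Qed.

Lemma le_mix n (t : nat -> R) z z' (u v : n.-tuple R) :
  {homo t : i j / (i <= j)%N >-> i <= j} ->
  z <= z' -> (forall i, tnth u i <= tnth v i) ->
  forall i, tnth (mix t z u) i <= tnth (mix t z' v) i.
Proof.
move=> ht zz' uv i; rewrite !tnth_mktuple lerD//.
  by rewrite ler_wpM2l// ltW// sech_gt0.
rewrite ler_wpM2l//; first by rewrite tanh_ge0// divr_ge0// subr_ge0 ht.
case: i => -[|i] ilt //=; have ilt' : (i < n)%N by [].
by have := uv (Ordinal ilt'); rewrite !(tnth_nth 0).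
Qed.

Theorem lower_association n (t : nat -> R) (A B : set (n.-tuple R)) :
  {homo t : i j / (i <= j)%N >-> i <= j} ->
  measurable A -> measurable B -> lower A -> lower B ->
  (P (sample Y n t @^-1` A) * P (sample Y n t @^-1` B) <=
   P (sample Y n t @^-1` (A `&` B)))%E.
Proof.
have msam m u (C : set (m.-tuple R)) : measurable C -> measurable (sample Y m u @^-1` C).
  by move=> mC; rewrite -[X in measurable X]setTI; exact: (@measurable_sample _ _ _ _ Y m u).
elim: n t A B => [|n IH] t A B ht mA mB lA lB.
  have E (C : set (0.-tuple R)) : sample Y 0 t @^-1` C = [set _ | C [tuple]].
    by apply/seteqP; split => w; rewrite /= (tuple0 (sample Y 0 t w)).
  rewrite !E; have [a|a] := pselect (A [tuple]); last first.
    rewrite (_ : [set _ | A [tuple]] = set0) ?measure0 ?mul0e//.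
    by apply/seteqP; split.
  rewrite (_ : [set _ | (A `&` B) [tuple]] = [set _ | B [tuple]]).
    rewrite -[leRHS]mul1e lee_wpmul2r//; apply: probability_le1.
    by rewrite -E; exact: msam.
  by apply/seteqP; split => w // -[].
have pmix (C : set (n.+1.-tuple R)) : measurable C -> P (sample Y n.+1 t @^-1` C) =
    (\int[gamma]_z P (sample Y n (t \o succn) @^-1` (mix t (r * z) @^-1` C)))%E.
  move=> mC; rewrite (probability_sample (t 0))//; apply: eq_integral => z _.
  by congr (P _); apply/seteqP; split => w /=; rewrite resample_mix.
pose p (C : set (n.+1.-tuple R)) (z : R) : R :=
  fine (P (sample Y n (t \o succn) @^-1` (mix t (r * z) @^-1` C))).
have mmix (C : set (n.+1.-tuple R)) z : measurable C -> measurable (mix t z @^-1` C).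
  by move=> mC; rewrite -[X in measurable X]setTI; exact: (@measurable_mix n t z).
have mpC (C : set (n.+1.-tuple R)) z : measurable C ->
    measurable (sample Y n (t \o succn) @^-1` (mix t (r * z) @^-1` C)).
  by move=> mC; exact: (msam _ _ _ (mmix C (r * z) mC)).
have pE (C : set (n.+1.-tuple R)) z : measurable C ->
    (P (sample Y n (t \o succn) @^-1` (mix t (r * z) @^-1` C)) = (p C z)%:E)%E.
  by move=> mC; rewrite /p fineK// fin_num_measure//; exact: mpC.
have p0 C z : 0 <= p C z by rewrite fine_ge0.
have bp C : measurable C -> bounded_mfun (p C : measurableTypeR R -> R).
  move=> mC; split; last first.
    exists 1 => z; rewrite ger0_norm// -lee_fin -pE//; apply: probability_le1.
    exact: mpC.
  apply/measurable_EFinP.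
  have := measurable_prob_resample (t 0) t mC; congr measurable_fun.
  apply/funext => z /=; rewrite -pE//.
  by congr (P _); apply/seteqP; split => w /=; rewrite resample_mix.
have dp C : measurable C -> lower C -> {homo p C : x y /~ x <= y}.
  move=> mC lC z z' zz'; rewrite -lee_fin -!pE//.
  apply: le_measure; rewrite ?inE; [exact: mpC..|].
  move=> w /=; apply: lC; apply: le_mix => //.
  by rewrite ler_wpM2l// ltW//; case: hr.
have P_int C : measurable C -> P (sample Y n.+1 t @^-1` C) = (\int[gamma]_z p C z)%:E.
  move=> mC; rewrite pmix//; under eq_integral do rewrite pE//.
  rewrite [RHS]fineK//; apply: integrable_fin_num => //.
  exact: bounded_mfun_integrable (bp _ mC).
have mAB : measurable (A `&` B) by exact: measurableI.
rewrite !P_int// -EFinM lee_fin.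
(* Chebyshev's inequality correlates the two events through the first value; for each fixed first
   value, the induction hypothesis then bounds [p A z * p B z] by [p (A & B) z]. *)
have := @nonincreasing_correlation _ gamma (p A) (p B) (bp _ mA) (bp _ mB)
  (p0 A) (dp _ mA lA) (dp _ mB lB).
move=> /le_trans; apply.
apply: le_Rintegral => //.
- exact: bounded_mfun_integrable (bounded_mfunM (bp _ mA) (bp _ mB)).
- exact: bounded_mfun_integrable (bp _ mAB).
- move=> z _; rewrite -lee_fin EFinM -!pE//.
  have ht' : {homo (t \o succn) : i j / (i <= j)%N >-> i <= j}.
    by move=> i j ij; exact: ht.
  have lz (C : set (n.+1.-tuple R)) : lower C -> lower (mix t (r * z) @^-1` C).
    by move=> lC u v uv; apply: lC; exact: le_mix.
  exact: (IH _ _ _ ht' (mmix A (r * z) mA) (mmix B (r * z) mB) (lz A lA) (lz B lB)).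
Qed.

End process_association.

(** * Crossings *)

Section normal_facts.
Context (R : realType).
Notation mu := (@lebesgue_measure R).
Notation gamma := (normal_prob 0 1 : probability _ R).
Notation phi := (normal_pdf (0 : R) 1).

Lemma normal_peak1_sqr : normal_peak (1 : R) ^+ 2 = (2 * pi)^-1.
Proof.
rewrite /normal_peak expr1n mul1r exprVn sqr_sqrtr; first by congr (_^-1); ring.
by rewrite mulrn_wge0// pi_ge0.
Qed.

Lemma is_derive_std_normal_pdf (x : R) :
  is_derive x 1 (fun y : R => - (normal_peak 1 * expR (- y ^+ 2 / 2)))
    (x * (normal_peak 1 * expR (- x ^+ 2 / 2))).
Proof.
by apply: is_derive_eq; rewrite /GRing.scale/= !mulr1 /GRing.scale/=; field.
Qed.

Lemma integral_pos_part_normal :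
  (\int[gamma]_x (Num.max 0 x)%:E = (normal_peak 1)%:E)%E.
Proof.
have mmax : measurable_fun setT (fun x : R => (Num.max 0 x)%:E).
  by apply/measurable_EFinP; exact: measurable_maxr.
rewrite ge0_integral_normal_prob//; last by move=> x; rewrite lee_fin le_max lexx.
pose f (x : R) := x * (normal_peak 1 * expR (- x ^+ 2 / 2)).
pose F (x : R) := - (normal_peak 1 * expR (- x ^+ 2 / 2)).
have cF : continuous F.
  by move=> x; apply: differentiable_continuous; apply/derivable1_diffP;
    exact: (@ex_derive _ _ _ _ _ _ _ (is_derive_std_normal_pdf x)).
have cf : continuous f.
  have -> : f = fun x => x * - F x by apply/funext => x; rewrite /f /F opprK.
  by move=> x; apply: cvgM; [exact: cvg_id|apply: cvgN; exact: cF].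
transitivity (\int[mu]_(x in `[0%R, +oo[) (f x)%:E)%E.
  rewrite [RHS]integral_mkcond; apply: eq_integral => x _.
  rewrite patchE; case: ifPn; rewrite mem_setE in_itv/= andbT.
    by move=> x0; rewrite max_r// std_normal_pdfE.
  rewrite -ltNge => x0.
  by rewrite max_l ?ltW// mul0e.
rewrite (@ge0_continuous_FTC2y _ f F 0 0).
- rewrite sub0e -EFinN /F opprK expr0n/= oppr0 mul0r expR0 mulr1//.
- by move=> x x0; rewrite /f mulr_ge0// mulr_ge0 ?normal_peak_ge0 ?expR_ge0.
- by apply: continuous_subspaceT.
- rewrite -oppr0; apply: cvgN; rewrite -(mulr0 (normal_peak 1)); apply: cvgM; first exact: cvg_cst.
  rewrite (_ : (fun x => _) = fun x => expR (- (x ^+ 2 * 2^-1))); last first.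
    by apply/funext => x; rewrite mulNr.
  apply: (cvg_comp (fun x => x ^+ 2 * 2^-1) (fun x => expR (- x))) (@cvgr_expR R).
  by apply: gt0_cvgMly; [rewrite invr_gt0|exact: cvgr_expr2].
- by move=> x _; exact: (@ex_derive _ _ _ _ _ _ _ (is_derive_std_normal_pdf x)).
- by apply: cvg_at_right_filter; exact: cF.
- by move=> x _; rewrite derive1E; exact: (@derive_val _ _ _ _ _ _ _ (is_derive_std_normal_pdf x)).
Qed.

(** The indicators of [x <= 0] and [- x <= 0] have equal integrals and sum to 1 plus the indicator
    of the null set [{0}]. *)
Lemma normal_prob_neg : (\int[gamma]_x (x <= 0)%R%:R%:E = 2^-1%:E)%E.
Proof.
have mn : measurable_fun setT (fun x : R => (x <= 0)%R%:R%:E : \bar R).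
  apply/measurable_EFinP; rewrite (_ : (fun _ => _) = \1_(`]-oo, 0]%classic)).
    exact: measurable_indic.
  by apply/funext => x; rewrite indicE mem_setE in_itv.
have n0 (x : R) : (0 <= (x <= 0)%R%:R%:E :> \bar R)%E by rewrite lee_fin.
have mN : measurable_fun setT (fun x : R => (- x <= 0)%R%:R%:E : \bar R).
  exact: (measurableT_comp mn).
have half (x : \bar R) : (2%:E * x = 1 -> x = 2^-1%:E)%E.
  case: x => [x||]; [|by rewrite mulry gtr0_sg// mul1e|by rewrite mulrNy gtr0_sg// mul1e].
  by rewrite -EFinM => -[x2]; congr EFin; lra.
apply: half.
have null : (\int[gamma]_x (\1_[set 0%R] x : R)%:E = 0)%E.
  rewrite integral_indic// setIT.
  have := @normal_prob_dominates R 0 1 => /null_content_dominatesP; apply => //.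
  exact: lebesgue_measure_set1.
transitivity (\int[gamma]_x ((x <= 0)%R%:R%:E + (- x <= 0)%R%:R%:E))%E; last first.
  transitivity (\int[gamma]_x (1%:E + (\1_[set 0%R] x : R)%:E))%E.
    apply: eq_integral => x _; rewrite -!EFinD oppr_le0 indicE; congr EFin.
    rewrite (_ : (x \in [set 0]) = (x == 0)); last by apply/idP/eqP; rewrite inE.
    by case: (ltrgt0P x) => //= _; rewrite ?addr0 ?add0r.
  rewrite ge0_integralD//; last exact/measurable_EFinP/measurable_indic.
  by rewrite integral_prob_cst null adde0.
rewrite ge0_integralD// (@ge0_integral_gammaN _ (fun x => (x <= 0)%R%:R%:E))//.
by rewrite -mule2n mule_natl.
Qed.

End normal_facts.

Section crossings.
Context (R : realType) (d : measure_display) (Omega : measurableType d)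
  (P : probability Omega R) (Y : R -> {RV P >-> R}).
Hypothesis hY : sech_gaussian_process Y.
Context (r : R) (hr : process_law Y r).
Notation mu := (@lebesgue_measure R).
Notation gamma := (normal_prob 0 1 : probability _ R).

Lemma process_law1 u (g : R -> \bar R) : measurable_fun setT g ->
  (forall x, 0 <= g x)%E ->
  (\int[P]_w g (Y u w) = \int[gamma]_x g (r * x)%R)%E.
Proof.
move=> mg g0; have [_ law] := hr.
have := law 1 (fun=> u) (fun=> 1) g mg g0.
rewrite /covq !big_ord1 subrr mul0r sech0 !mulr1 sqrtr1 mulr1 => <-.
by apply: eq_integral => w _; rewrite big_ord1 mul1r.
Qed.

Lemma normal_prob_itv_le (c : R) : 0 <= c ->
  (\int[gamma]_x (\1_(`]- c, 0]) x)%:E <= (normal_peak 1 * c)%:E)%E.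
Proof.
move=> c0; have mi : measurable_fun setT (fun x : R => (\1_(`]- c, 0]%classic) x : R)%:E).
  by apply/measurable_EFinP; exact: measurable_indic.
rewrite ge0_integral_normal_prob//.
apply: (@le_trans _ _ (\int[mu]_x ((normal_peak 1)%:E * (\1_(`]- c, 0]%classic) x : R)%:E))%E).
  apply: ge0_le_integral => //.
  - by move=> x _; rewrite mule_ge0// lee_fin normal_pdf_ge0.
  - by apply: emeasurable_funM => //; exact: measurable_phi.
  - exact: emeasurable_funM.
  - move=> x _; rewrite muleC lee_wpmul2r// lee_fin.
    by apply: normal_pdf_ub; exact: oner_neq0.
rewrite ge0_integralZl// ?lee_fin ?normal_peak_ge0//.
rewrite integral_indic// setIT.
rewrite [X in (_ * X)%E](_ : _ = mu `]- c, 0]%classic)// lebesgue_measure_itv/= lte_fin.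
case: ifPn => _; first by rewrite -?EFinD /= ?opprK ?add0r -?EFinM ?opprK ?lexx.
by rewrite mule0 lee_fin mulr_ge0// normal_peak_ge0.
Qed.

(** Resample at [s]. For a given value [y] of the independent copy at [u], the event forces [y > 0]
    and puts [Y s] in an interval of length [y * tanh / sech] ending at 0. Bounding the density by
    its peak and averaging the positive part of [y] gives two factors [normal_peak 1], whose product
    is [1 / (2 * pi)]; the scale [r] cancels. *)
Lemma crossing_probability s u : s < u ->
  (P [set w | (Y s w <= 0 < Y u w)%R] <=
   (tanh ((u - s) / 2) / sech ((u - s) / 2) / (2 * pi))%:E)%E.
Proof.
move=> su; have [r0 _] := hr.
set h := tanh _; set rho := sech _.
have h0 : 0 < h by rewrite tanh_gt0// divr_gt0// subr_gt0.
have rho0 : 0 < rho by exact: sech_gt0.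
pose t (i : nat) := if i is 0%N then s else u.
pose A : set (2.-tuple R) := [set v | tnth v ord0 <= 0 < tnth v ord_max].
have mA : measurable A.
  have -> : A = (fun v => tnth v ord0) @^-1` `]-oo, 0] `&`
      (fun v => tnth v ord_max) @^-1` `]0, +oo[.
    apply/seteqP; split => v /=; rewrite !in_itv/= andbT.
      by move=> /andP[].
    by move=> [v0 v1]; apply/andP.
  by apply: measurableI; rewrite -[X in measurable X]setTI; exact: measurable_tnth.
have mF : measurable_fun setT (fun v : 2.-tuple R => (\1_A v : R)%:E).
  by apply/measurable_EFinP; exact: measurable_indic.
have -> : [set w | Y s w <= 0 < Y u w] = sample Y 2 t @^-1` A.
  by apply/seteqP; split => w; rewrite /A /= !tnth_mktuple.
have -> : P (sample Y 2 t @^-1` A) = (\int[P]_w (\1_A (sample Y 2 t w))%:E)%E.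
  rewrite -(setIT (_ @^-1` A)) -(integral_indic P measurableT)//.
  by rewrite -[X in measurable X]setTI; exact: (@measurable_sample _ _ _ _ Y 2 t).
rewrite (ge0_expectation_resample hr s t (F := fun v => (\1_A v)%:E))//.
rewrite (@fubini_tonelli _ _ _ _ _ gamma P
  (fun zw => (\1_A (resample Y s 2 t (r * zw.1) zw.2))%:E))/=; last 2 first.
- exact: (measurableT_comp mF (measurable_resample2 Y r s (n := 2) t)).
- by move=> zw; rewrite lee_fin.
pose k := normal_peak 1 * (h / (rho * r)).
have rr0 : 0 < rho * r by exact: mulr_gt0.
have hr0 : 0 <= h / (rho * r) by rewrite divr_ge0// ltW.
have k0 : 0 <= k by exact: mulr_ge0 (normal_peak_ge0 _) hr0.
have mmax : measurable_fun setT (fun x : R => (Num.max 0 x)%:E).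
  by apply/measurable_EFinP; exact: measurable_maxr.
have max0 (x : R) : (0 <= (Num.max 0 x)%:E)%E by rewrite lee_fin le_max lexx.
have mmaxY : measurable_fun setT (fun w => (Num.max 0 (Y u w))%:E).
  exact: (measurableT_comp mmax (measurable_process Y u)).
apply: (@le_trans _ _ (\int[P]_w (k%:E * (Num.max 0 (Y u w))%:E))%E).
  apply: ge0_le_integral => //.
  - by move=> w _; apply: integral_ge0 => z _; rewrite lee_fin.
  - apply: (@measurable_fun_fubini_tonelli_G _ _ _ _ _ gamma
      (fun zw => (\1_A (resample Y s 2 t (r * zw.1) zw.2))%:E)).
      exact: (measurableT_comp mF (measurable_resample2 Y r s (n := 2) t)).
    by move=> zw; rewrite lee_fin.
  - exact: emeasurable_funM.
  - move=> w _; pose c := h / (rho * r) * Num.max 0 (Y u w).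
    have c0 : 0 <= c by rewrite mulr_ge0// le_max lexx.
    rewrite -EFinM -mulrA; apply: le_trans (normal_prob_itv_le c0).
    apply: ge0_le_integral => //.
    + apply: (measurableT_comp mF).
      exact: (measurableT_comp (measurable_resample2 Y r s (n := 2) t) (pair2_measurable w)).
    + by apply/measurable_EFinP; exact: measurable_indic.
    + move=> z _; rewrite lee_fin !indicE.
      case: (boolP (_ \in A)) => [/set_mem|_]; last by rewrite ler0n.
      rewrite /A/= !tnth_mktuple/= subrr mul0r sech0 tanh0 mul1r mul0r addr0.
      move=> /andP[rz0 hz]; rewrite mem_setE in_itv/=.
      have z0 : z <= 0 by rewrite -(pmulr_rle0 _ r0).
      suff -> : - c < z by rewrite z0.
      rewrite ltrNl.
      have hY0 : - (rho * (r * z)) < h * Y u w by rewrite -subr_gt0 opprK addrC.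
      have Y0 : 0 < Y u w.
        rewrite -(pmulr_rgt0 _ h0); apply: le_lt_trans hY0.
        by rewrite oppr_ge0 pmulr_rle0.
      rewrite /c max_r ?ltW// mulrAC (ltr_pdivlMr _ _ rr0).
      by have -> : - z * (rho * r) = - (rho * (r * z)) by ring.
rewrite ge0_integralZl// (process_law1 _ mmax)//.
have -> : (\int[gamma]_x (Num.max 0 (r * x))%:E =
    r%:E * \int[gamma]_x (Num.max 0 x)%:E)%E.
  rewrite -ge0_integralZl//; last by rewrite lee_fin ltW.
  by apply: eq_integral => x _; rewrite -EFinM maxr_pMr ?ltW// mulr0.
rewrite integral_pos_part_normal -!EFinM lee_fin -normal_peak1_sqr /k.
rewrite le_eqVlt; apply/orP; left; apply/eqP.
by field; rewrite !gt_eqF.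
Qed.

End crossings.

(** * Density *)

Section precision.
Context (R : realType).
Implicit Types (t y a : nat -> R).

(* [precision n t y] is the quadratic form of the inverse covariance matrix of
   [(Y (t i))_(i < n)], and [cholesky n t] the square root of its determinant. *)
Fixpoint precision n t y : R := if n is n'.+1 then
    y 0 ^+ 2 + precision n' (t \o succn)
      (fun i => (y i.+1 - sech ((t i.+1 - t 0) / 2) * y 0) / tanh ((t i.+1 - t 0) / 2))
  else 0.

Fixpoint cholesky n t : R := if n is n'.+1 then
    cholesky n' (t \o succn) * \prod_(i < n') tanh ((t i.+1 - t 0) / 2)
  else 1.

Lemma eq_precision n t y y' : (forall i, (i < n)%N -> y i = y' i) ->
  precision n t y = precision n t y'.
Proof.
elim: n t y y' => //= n IH t y y' yy'; rewrite yy'//; congr (_ + _).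
by apply: IH => i ilt; rewrite yy'.
Qed.

Lemma measurable_precision d (T : measurableType d) n t (y : nat -> T -> R) :
  (forall i, measurable_fun setT (y i)) ->
  measurable_fun setT (fun w => precision n t (y ^~ w)).
Proof.
elim: n t y => [|n IH] t y my /=; first exact: measurable_cst.
apply: measurable_funD; first exact: measurable_funX.
apply: (IH _ (fun i w => (y i.+1 w - sech ((t i.+1 - t 0) / 2) * y 0 w) /
  tanh ((t i.+1 - t 0) / 2))) => i.
by apply: measurable_funM => //; apply: measurable_funB => //; exact: measurable_funM.
Qed.

Lemma tanh_incr_gt0 t i : {homo t : i j / (i < j)%N >-> i < j} ->
  0 < tanh ((t i.+1 - t 0) / 2).
Proof. by move=> ht; rewrite tanh_gt0// divr_gt0// subr_gt0 ht. Qed.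

Lemma cholesky_gt0 n t : {homo t : i j / (i < j)%N >-> i < j} -> 0 < cholesky n t.
Proof.
elim: n t => //= n IH t ht; rewrite mulr_gt0//; first by apply: IH => i j ij; exact: ht.
by apply: prodr_gt0 => i _; exact: tanh_incr_gt0.
Qed.

(** Fenchel inequality between a quadratic form and its inverse, obtained without inverting a
    matrix: splitting both sides along the resampling at [t 0] leaves exactly the square
    [(y 0 - m) ^ 2]. *)
Lemma precision_ge n t y a : {homo t : i j / (i < j)%N >-> i < j} ->
  2 * (\sum_(i < n) a i * y i) - covq t (fun i : 'I_n => a i) <= precision n t y.
Proof.
elim: n t y a => [|n IH] t y a ht; first by rewrite /covq !big_ord0 mulr0 subr0.
have ht' : {homo (t \o succn) : i j / (i < j)%N >-> i < j} by move=> i j ij; exact: ht.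
pose b i := a i.+1 * tanh ((t i.+1 - t 0) / 2).
pose x i := (y i.+1 - sech ((t i.+1 - t 0) / 2) * y 0) / tanh ((t i.+1 - t 0) / 2).
have := IH _ x b ht'; rewrite /= -/x.
pose m := a 0 + \sum_(i < n) a i.+1 * sech ((t i.+1 - t 0) / 2).
have -> : covq t (fun i : 'I_n.+1 => a i) = m ^+ 2 + covq (t \o succn) (fun i : 'I_n => b i).
  rewrite -(covq_split (t 0)) big_ord_recl subrr mul0r sech0 mulr1; congr (_ ^+ 2 + _).
  rewrite /covq big_ord_recl subrr mul0r tanh0 mulr0 big1 ?add0r; last first.
    by move=> j _; rewrite !mul0r.
  apply: eq_bigr => i _; rewrite big_ord_recl subrr mul0r tanh0 !mulr0 mul0r add0r.
  by apply: eq_bigr.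
have -> : \sum_(i < n.+1) a i * y i = y 0 * m + \sum_(i < n) b i * x i.
  rewrite big_ord_recl /m mulrDr mulr_sumr mulrC -addrA -big_split/=; congr (_ + _).
  apply: eq_bigr => i _; rewrite /b /x /bump/= add1n.
  by field; rewrite gt_eqF// tanh_incr_gt0.
have := sqr_ge0 (y 0 - m); nra.
Qed.

(** The choice [a = y / lam] in [precision_ge] gives [2 * |y| ^ 2 / lam] minus at most
    [|y| ^ 2 / lam]. *)
Lemma precision_norm_ge n t y lam : {homo t : i j / (i < j)%N >-> i < j} -> 0 < lam ->
  covq t (fun i : 'I_n => y i) <= lam * \sum_(i < n) y i ^+ 2 ->
  (\sum_(i < n) y i ^+ 2) / lam <= precision n t y.
Proof.
move=> ht lam0 hlam; apply: le_trans (precision_ge _ _ (fun i => y i / lam) ht).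
have -> : covq t (fun i : 'I_n => y i / lam) = covq t (fun i : 'I_n => y i) / lam ^+ 2.
  rewrite /covq mulr_suml; apply: eq_bigr => i _; rewrite mulr_suml.
  by apply: eq_bigr => j _; field; rewrite gt_eqF.
have -> : \sum_(i < n) y i / lam * y i = (\sum_(i < n) y i ^+ 2) / lam.
  by rewrite mulr_suml; apply: eq_bigr => i _; rewrite expr2 mulrAC.
rewrite mulr_natl mulr2n -addrA lerDl subr_ge0.
rewrite ler_pdivrMr ?exprn_gt0// expr2 mulrA divfK ?gt_eqF//.
by rewrite mulrC.
Qed.

End precision.

Section density.
Context (R : realType) (d : measure_display) (Omega : measurableType d)
  (P : probability Omega R) (Y : R -> {RV P >-> R}).
Hypothesis hY : sech_gaussian_process Y.
Context (r : R) (hr : process_law Y r).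
Notation mu := (@lebesgue_measure R).
Notation gamma := (normal_prob 0 1 : probability _ R).

(* The tilt cancels the Gaussian density of [(Y (t i))_(i < n)] up to a constant, so
   the expectation of [tilted] is a product of Lebesgue integrals. *)
Definition tilted n (t : nat -> R) (f : nat -> R -> R) (y : nat -> R) : R :=
  expR (precision n t y / (2 * r ^+ 2)) * \prod_(i < n) f i (y i).

Lemma measurable_tilted d' (T : measurableType d') n (t : nat -> R) (f : nat -> R -> R)
    (y : nat -> T -> R) : (forall i, measurable_fun setT (f i)) ->
  (forall i, measurable_fun setT (y i)) ->
  measurable_fun setT (fun w => (tilted n t f (y ^~ w))%:E).
Proof.
move=> mf my; apply/measurable_EFinP; apply: measurable_funM.
  apply: (measurableT_comp (continuous_measurable_fun (@continuous_expR R))).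
  by apply: measurable_funM => //; exact: measurable_precision.
by apply: measurable_prod => i _; exact: (measurableT_comp (mf i)).
Qed.

Lemma tilted_ge0 n (t : nat -> R) (f : nat -> R -> R) (y : nat -> R) :
  (forall i x, 0 <= f i x) -> 0 <= tilted n t f y.
Proof. by move=> f0; rewrite mulr_ge0 ?expR_ge0// prodr_ge0. Qed.

Lemma eq_tilted n (t : nat -> R) (f : nat -> R -> R) (y y' : nat -> R) :
  (forall i, (i < n)%N -> y i = y' i) -> tilted n t f y = tilted n t f y'.
Proof.
move=> yy'; rewrite /tilted (eq_precision _ yy').
by under eq_bigr do rewrite yy'//.
Qed.

Lemma tiltedS n (t : nat -> R) (f : nat -> R -> R) (y : nat -> R) :
  {homo t : i j / (i < j)%N >-> i < j} ->
  tilted n.+1 t f y = expR (y 0 ^+ 2 / (2 * r ^+ 2)) * f 0 (y 0) *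
    tilted n (t \o succn)
      (fun i x => f i.+1 (sech ((t i.+1 - t 0) / 2) * y 0 + tanh ((t i.+1 - t 0) / 2) * x))
      (fun i => (y i.+1 - sech ((t i.+1 - t 0) / 2) * y 0) / tanh ((t i.+1 - t 0) / 2)).
Proof.
move=> ht; rewrite /tilted/= big_ord_recl mulrDl expRD -!mulrA; congr (_ * _).
rewrite [LHS]mulrCA; congr (_ * (_ * _)); apply: eq_bigr => i _.
congr (f _ _); rewrite mulrCA divff ?mulr1; first by rewrite addrC subrK.
by rewrite gt_eqF// tanh_incr_gt0.
Qed.

Lemma measurable_nth n i : measurable_fun setT (fun v : n.-tuple R => nth 0 v i).
Proof.
have [ilt|ige] := ltnP i n.
  rewrite (_ : (fun _ => _) = fun v : n.-tuple R => tnth v (Ordinal ilt)).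
    exact: measurable_tnth.
  by apply/funext => v; rewrite (tnth_nth 0).
rewrite (_ : (fun _ => _) = cst 0); first exact: measurable_cst.
by apply/funext => v; rewrite nth_default// size_tuple.
Qed.

Lemma nth_sample n (t : nat -> R) w i : (i < n)%N ->
  nth 0 (sample Y n t w) i = Y (t i) w.
Proof.
move=> ilt; have := tnth_nth 0 (sample Y n t w) (Ordinal ilt).
by rewrite tnth_mktuple.
Qed.

Lemma nth_resample s n (t : nat -> R) z w i : (i < n)%N ->
  nth 0 (resample Y s n t z w) i =
  sech ((t i - s) / 2) * z + tanh ((t i - s) / 2) * Y (t i) w.
Proof.
move=> ilt; have := tnth_nth 0 (resample Y s n t z w) (Ordinal ilt).
by rewrite tnth_mktuple.
Qed.

(** At each resampling [expR (z ^+ 2 / 2)] cancels the normal density up to [normal_peak 1], and the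
    scaling [r * z] costs [1 / r]. The affine maps on the later coordinates cost one [1 / tanh]
    each, and these accumulate to [1 / cholesky]. *)
Lemma expectation_tilted n (t : nat -> R) (f : nat -> R -> R) (v : nat -> R) :
  {homo t : i j / (i < j)%N >-> i < j} ->
  (forall i, measurable_fun setT (f i)) -> (forall i x, 0 <= f i x) ->
  (forall i, \int[mu]_x (f i x)%:E = (v i)%:E)%E ->
  (\int[P]_w (tilted n t f (fun i => Y (t i) w))%:E =
   ((normal_peak 1 / r) ^+ n / cholesky n t * \prod_(i < n) v i)%:E)%E.
Proof.
have [r0 _] := hr.
elim: n t f v => [|n IH] t f v ht mf f0 fv.
  under eq_integral do rewrite /tilted/= mul0r expR0 big_ord0 mulr1.
  by rewrite integral_prob_cst big_ord0 expr0 divr1 mulr1.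
have ht' : {homo (t \o succn) : i j / (i < j)%N >-> i < j} by move=> i j ij; exact: ht.
pose rho i := sech ((t i.+1 - t 0) / 2).
pose h i := tanh ((t i.+1 - t 0) / 2).
have h0 i : 0 < h i by exact: tanh_incr_gt0.
pose F (u : n.+1.-tuple R) := (tilted n.+1 t f (fun i => nth 0 u i))%:E.
transitivity (\int[P]_w F (sample Y n.+1 t w))%E.
  apply: eq_integral => w _; congr EFin; apply: eq_tilted => i ilt.
  by rewrite nth_sample.
rewrite (ge0_expectation_resample hr (t 0) t (F := F) hY); last 2 first.
- apply: (measurable_tilted _ _ (y := fun i (u : n.+1.-tuple R) => nth 0 u i)) => // i.
  exact: measurable_nth.
- by move=> u; rewrite lee_fin tilted_ge0.
pose C := (normal_peak 1 / r) ^+ n / cholesky n (t \o succn) * \prod_(i < n) ((h i)^-1 * v i.+1).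
transitivity (\int[gamma]_z ((expR (z ^+ 2 / 2) * f 0%N (r * z))%:E * C%:E))%E.
  apply: eq_integral => z _.
  (* [f'] absorbs the contribution of the value already drawn. By translation invariance its
     integral [(h i)^-1 * v i.+1] does not depend on [z], so the integral over [z] factors out. *)
  pose f' i x := f i.+1 (rho i * (r * z) + h i * x).
  rewrite -(IH (t \o succn) f' (fun i => (h i)^-1 * v i.+1))//; last 3 first.
  - by move=> i; apply: (measurableT_comp (mf i.+1)); exact: measurable_affine.
  - by move=> i x; exact: f0.
  - move=> i; rewrite EFinM -fv.
    rewrite (@ge0_integral_affine _ (rho i * (r * z)) (h i) (fun x => (f i.+1 x)%:E))//.
    + by rewrite muleA -EFinM mulVf ?mul1e// gt_eqF.
    + exact/measurable_EFinP.
    + by move=> x; rewrite lee_fin.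
  rewrite -ge0_integralZl//; last 3 first.
  - apply: (measurable_tilted _ _ (y := fun i w => Y ((t \o succn) i) w)) => i; last first.
      exact: (measurable_process Y (t i.+1)).
    by apply: (measurableT_comp (mf i.+1)); exact: measurable_affine.
  - by move=> w _; rewrite lee_fin tilted_ge0// => i x; exact: f0.
  - by rewrite lee_fin mulr_ge0// expR_ge0.
  apply: eq_integral => w _; rewrite -EFinM /F; congr EFin.
  rewrite tiltedS// nth_resample// subrr mul0r sech0 tanh0 mul0r addr0 mul1r.
  congr (expR _ * _ * _); first by field; rewrite gt_eqF.
  apply: eq_tilted => i ilt; rewrite nth_resample// -/(rho i) -/(h i).
  by rewrite addrAC subrr add0r mulrC mulKf// gt_eqF.
have vC : \prod_(i < n) ((h i)^-1 * v i.+1) =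
    (\prod_(i < n) h i)^-1 * \prod_(i < n) v i.+1.
  by rewrite big_split/= prodfV.
have g0 z : 0 <= expR (z ^+ 2 / 2) * f 0%N (r * z).
  by rewrite mulr_ge0// expR_ge0.
have mg : measurable_fun setT (fun z : R => (expR (z ^+ 2 / 2) * f 0%N (r * z))%:E).
  apply/measurable_EFinP; apply: measurable_funM.
    apply: (measurableT_comp (continuous_measurable_fun (@continuous_expR R))).
    by apply: measurable_funM => //; exact: measurable_funX.
  by apply: (measurableT_comp (mf 0%N)); exact: measurable_funM.
have v0 i : 0 <= v i.
  by rewrite -lee_fin -fv integral_ge0// => x _; rewrite lee_fin.
have C0 : 0 <= C.
  rewrite /C vC !mulr_ge0 ?prodr_ge0 ?exprn_ge0 ?divr_ge0 ?normal_peak_ge0 ?invr_ge0 ?ltW//.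
    exact: cholesky_gt0.
  by apply: prodr_gt0 => i _; exact: h0.
rewrite ge0_integralZr//; last by move=> z _; rewrite lee_fin.
rewrite ge0_integral_normal_prob//.
rewrite (_ : (\int[mu]_x _)%E = (normal_peak 1 / r * v 0%N)%:E); last first.
  rewrite EFinM -fv (@ge0_integral_affine _ 0 r (fun x => (f 0%N x)%:E))//; last 2 first.
  - exact/measurable_EFinP.
  - by move=> x; rewrite lee_fin.
  rewrite muleA -EFinM divfK ?gt_eqF// -ge0_integralZl//; last 3 first.
  - apply/measurable_EFinP; apply: (measurableT_comp (mf 0%N)).
    exact: measurable_affine.
  - by move=> x _; rewrite lee_fin.
  - by rewrite lee_fin normal_peak_ge0.
  apply: eq_integral => x _; rewrite -!EFinM add0r; congr EFin.
  have e : expR (x ^+ 2 / 2) * expR (- x ^+ 2 / 2) = 1.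
    by rewrite -expRD mulNr subrr expR0.
  rewrite std_normal_pdfE -[RHS]mulr1 -[X in _ = _ * X]e; ring.
rewrite -EFinM; congr EFin; rewrite /C vC big_ord_recl/= exprS.
rewrite -[in RHS]/(h _) invfM; ring.
Qed.

(** The indicator of the event is at most [tilted] for half-Gaussians of variance [r ^ 2 * lam]: on
    the event the product of the [f i] is [expR (- |y| ^ 2 / (2 * r ^ 2 * lam))], which the tilt
    compensates by [precision_norm_ge]. *)
Lemma probability_nonpositive_le n (t : nat -> R) lam :
  {homo t : i j / (i < j)%N >-> i < j} -> 0 < lam ->
  (forall y : nat -> R,
    covq t (fun i : 'I_n => y i) <= lam * \sum_(i < n) y i ^+ 2) ->
  (P [set w | forall i, (i < n)%N -> (Y (t i) w <= 0)%R] <=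
   ((Num.sqrt lam / 2) ^+ n / cholesky n t)%:E)%E.
Proof.
move=> ht lam0 hlam; have [r0 _] := hr.
pose f (i : nat) (x : R) := (x <= 0)%R%:R * expR (- x ^+ 2 / (2 * r ^+ 2 * lam)).
pose c := r * Num.sqrt lam.
have c0 : 0 < c by rewrite mulr_gt0// sqrtr_gt0.
have mneg : measurable_fun setT (fun x : R => (x <= 0)%R%:R : R).
  rewrite (_ : (fun _ => _) = \1_(`]-oo, 0]%classic)); first exact: measurable_indic.
  by apply/funext => x; rewrite indicE mem_setE in_itv.
have mf i : measurable_fun setT (f i).
  apply: measurable_funM => //.
  apply: (measurableT_comp (continuous_measurable_fun (@continuous_expR R))).
  apply: measurable_funM => //; apply: measurable_funN; exact: measurable_funX.
have f0 i x : 0 <= f i x by rewrite mulr_ge0// expR_ge0.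
have fv i : (\int[mu]_x (f i x)%:E = (c / (2 * normal_peak 1))%:E)%E.
  rewrite (@ge0_integral_affine _ 0 c (fun x => (f i x)%:E))//; last 2 first.
  - exact/measurable_EFinP.
  - by move=> x; rewrite lee_fin.
  have pk : normal_peak (1 : R) != 0 by rewrite gt_eqF// normal_peak_gt0// oner_neq0.
  (* The half-Gaussian integral is read off from the mass [1 / 2] of the negative half-line, after
     rescaling by [c]. *)
  have := normal_prob_neg R; rewrite ge0_integral_normal_prob//; last first.
    exact/measurable_EFinP.
  rewrite (_ : (\int[mu]_x (_ * _))%E =
      (normal_peak 1)%:E * \int[mu]_x (f i (0 + c * x))%:E)%E; last first.
    rewrite -ge0_integralZl//; last 3 first.
    - apply/measurable_EFinP; apply: (measurableT_comp (mf i)).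
      exact: measurable_affine.
    - by move=> x _; rewrite lee_fin.
    - by rewrite lee_fin normal_peak_ge0.
    apply: eq_integral => x _; rewrite -!EFinM /f add0r pmulr_rle0// std_normal_pdfE.
    congr EFin; rewrite mulrCA; congr (_ * (_ * expR _)).
    rewrite exprMn /c exprMn sqr_sqrtr ?ltW//; field.
    by rewrite !gt_eqF.
  case: (\int[mu]_x _)%E => [v||].
  - rewrite -!EFinM => -[pv]; congr EFin.
    by rewrite -[v](mulKf pk) pv; field.
  - by rewrite mulry gtr0_sg ?mul1e// normal_peak_gt0// oner_neq0.
  - by rewrite mulrNy gtr0_sg ?mul1e// normal_peak_gt0// oner_neq0.
have := expectation_tilted n ht mf f0 fv.
rewrite prodr_const card_ord => E.
rewrite (_ : (_ / _) ^+ n / _ = (normal_peak 1 / r) ^+ n / cholesky n t *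
  (c / (2 * normal_peak 1)) ^+ n); last first.
  rewrite mulrAC -exprMn; congr (_ ^+ n / _); rewrite /c; field.
  by rewrite !gt_eqF// normal_peak_gt0// oner_neq0.
rewrite -E.
set A := [set w | _].
have mA : measurable A.
  rewrite (_ : A = \bigcap_(i in `I_n) (Y (t i)) @^-1` `]-oo, 0]); last first.
    apply/seteqP; split => w /= h i ilt; have := h i ilt; by rewrite /= in_itv.
  apply: fin_bigcap_measurable => // i _.
  by rewrite -[X in measurable X]setTI; apply: (measurable_process Y (t i)).
rewrite -(setIT A) -(integral_indic P measurableT)//.
apply: ge0_le_integral => //.
- by apply/measurable_EFinP; exact: measurable_indic.
- exact: (measurable_tilted n t mf (fun i => measurable_process Y (t i))).
move=> w _; rewrite lee_fin indicE.
case: (boolP (w \in A)) => [/set_mem wA|_]; last exact: tilted_ge0.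
rewrite /tilted /f big_split/= big1 ?mul1r; last by move=> i _; rewrite wA.
rewrite -expR_sum -expRD (le_trans _ (expR_ge1Dx _))// lerDl.
have := precision_norm_ge ht lam0 (hlam (fun i => Y (t i) w)).
rewrite -mulr_suml sumrN ler_pdivrMr// => H.
rewrite mulNr subr_ge0 ler_pdivrMr ?mulr_gt0 ?exprn_gt0//.
apply: le_trans H _; rewrite le_eqVlt; apply/orP; left; apply/eqP.
by field; rewrite gt_eqF.
Qed.

End density.

(** * Lattice constants *)

Section hyperbolic_bounds.
Context (R : realType).
Implicit Types u : R.

Lemma sech_le_expR u : sech u <= 2 * expR (- u).
Proof.
rewrite /sech ler_pdivrMr ?expRDN_gt0// -mulrA ler_peMr// mulrDr -!expRD addNr expR0.
by rewrite lerDl expR_ge0.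
Qed.

Lemma tanh_ge_expR u : 1 - 2 * expR (- u) ^+ 2 <= tanh u.
Proof.
rewrite /tanh ler_pdivlMr ?expRDN_gt0// expRN.
have x0 := expR_gt0 u; set x := expR u in x0 *.
rewrite -subr_ge0.
have -> : x - x^-1 - (1 - 2 * x^-1 ^+ 2) * (x + x^-1) = 2 * x^-1 ^+ 3.
  by field; rewrite gt_eqF.
by rewrite mulr_ge0// exprn_ge0// invr_ge0 ltW.
Qed.

(** The left side is [sinh u = expR u * (1 - expR (- 2 * u)) / 2], and
    [1 - expR (- 2 * u) <= 2 * u]. The spare factor [expR u] tends to 1 on fine grids. *)
Lemma sinh_le u : tanh u / sech u <= u * expR u.
Proof.
have x0 := expR_gt0 u.
have -> : tanh u / sech u = (expR u - expR (- u)) / 2.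
  rewrite /tanh /sech; field.
  by rewrite gt_eqF// expRDN_gt0.
have := expR_ge1Dx (- (2 * u)).
rewrite (_ : expR (- (2 * u)) = expR (- u) ^+ 2); last first.
  by rewrite -expRM_natl; congr expR; ring.
rewrite !expRN; move: x0; set x := expR u => x0 h.
rewrite ler_pdivrMr// lerBlDr -(ler_pM2r (x := x^-1)) ?invr_gt0//.
rewrite divff ?gt_eqF//.
have -> : (u * x * 2 + x^-1) / x = 2 * u + x^-1 ^+ 2 by field; rewrite gt_eqF.
lra.
Qed.

End hyperbolic_bounds.

Section lattice.
Context (R : realType).
Notation q := (10^-1 : R).

(* Step of the lattice, for which [sech] and [tanh] become rational. *)
Definition step : R := 2 * ln 10.

Lemma step_gt0 : 0 < step.
Proof. by rewrite mulr_gt0// ln_gt0// ltr1n. Qed.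

Lemma expR_lattice k : expR (- (k%:R * step / 2)) = q ^+ k.
Proof.
rewrite (_ : - _ = k%:R * - ln 10); last by rewrite /step; field.
by rewrite expRM_natl expRN lnK// posrE.
Qed.

Lemma sech_lattice_ord (t : nat -> R) i j : (forall k, t k = t 0%N + k%:R * step) ->
  (i <= j)%N -> sech ((t j - t i) / 2) <= 2 * q ^+ (j - i).
Proof.
move=> ht ij; rewrite -expR_lattice natrB// (ht i) (ht j).
apply: le_trans (sech_le_expR _) _; rewrite le_eqVlt; apply/orP; left; apply/eqP.
by congr (_ * expR _); field.
Qed.

(* [13 / 9 = 1 + 4 / 10 + 4 / 10 ^ 2 + ...], bounding [sech] by [2 * expR (- u)] on
   both sides of the diagonal. *)
Lemma sech_row_sum (t : nat -> R) n i : (forall k, t k = t 0%N + k%:R * step) ->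
  \sum_(j < n) sech ((t j - t i) / 2) <= 13 / 9.
Proof.
move=> ht.
(* The induction needs exact geometric tails: before the diagonal the partial sum is bounded by the
   left series continued indefinitely; past it, [2 / 9 * q ^+ (n.-1 - i)] is the part of the right
   series still to come. *)
suff: \sum_(j < n) sech ((t j - t i) / 2) <= if (n <= i)%N then 2 / 9 * q ^+ (i - n)
    else 13 / 9 - 2 / 9 * q ^+ (n.-1 - i).
  move=> /le_trans; apply; case: ifP => _.
    have : q ^+ (i - n) <= 1 by rewrite exprn_ile1// ?invr_ge0// invf_le1// ler1n.
    lra.
  have : 0 <= q ^+ (n.-1 - i) by rewrite exprn_ge0// invr_ge0.
  lra.
elim: n => [|n IH]; first by rewrite big_ord0 leq0n mulr_ge0// exprn_ge0// invr_ge0.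
rewrite big_ord_recr/=; apply: le_trans (lerD IH (lexx _)) _.
have [ni|ni|ni] := ltngtP n i.
- have := sech_lattice_ord ht (ltnW ni).
  rewrite -sechN -mulNr opprB => sij; apply: le_trans (lerD (lexx _) sij) _.
  have -> : (i - n = (i - n.+1).+1)%N by rewrite subnSK.
  by rewrite exprS; move: (q ^+ _) => x; lra.
- have := sech_lattice_ord ht (ltnW ni).
  move=> sij; apply: le_trans (lerD (lexx _) sij) _.
  have -> : (n - i = (n.-1 - i).+1)%N by case: n ni {IH sij} => // n ni; rewrite subSn.
  by rewrite exprS; move: (q ^+ _) => x; lra.
- by rewrite ni subrr mul0r sech0 subnn expr0; lra.
Qed.

(** Schur's test: [y i * y j <= (y i ^+ 2 + y j ^+ 2) / 2] and the symmetry of the kernel reduce the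
    form to its row sums. *)
Lemma covq_lattice n (t y : nat -> R) : (forall k, t k = t 0%N + k%:R * step) ->
  covq t (fun i : 'I_n => y i) <= 13 / 9 * \sum_(i < n) y i ^+ 2.
Proof.
move=> ht; pose s (i j : 'I_n) := sech ((t j - t i) / 2).
have s0 i j : 0 <= s i j by rewrite ltW// sech_gt0.
have sC i j : s i j = s j i by rewrite /s -sechN -mulNr opprB.
have row : \sum_(i < n) \sum_(j < n) y i ^+ 2 * s i j <= 13 / 9 * \sum_(i < n) y i ^+ 2.
  rewrite mulr_sumr; apply: ler_sum => i _.
  by rewrite -mulr_sumr mulrC ler_wpM2r ?sqr_ge0// sech_row_sum.
apply: le_trans row.
have -> : \sum_(i < n) \sum_(j < n) y i ^+ 2 * s i j =
    \sum_(i < n) \sum_(j < n) (y i ^+ 2 + y j ^+ 2) / 2 * s i j.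
  transitivity (\sum_(i < n) \sum_(j < n) y i ^+ 2 * s i j / 2 +
      \sum_(i < n) \sum_(j < n) y j ^+ 2 * s i j / 2).
    rewrite [X in _ = _ + X]exchange_big/= -big_split/=; apply: eq_bigr => i _.
    by rewrite -big_split/=; apply: eq_bigr => j _; rewrite (sC j i); field.
  by rewrite -big_split/=; apply: eq_bigr => i _; rewrite -big_split/=;
    apply: eq_bigr => j _; field.
apply: ler_sum => i _; apply: ler_sum => j _.
rewrite -/(s i j) ler_wpM2r//; have := sqr_ge0 (y i - y j); nra.
Qed.

(* [2 / 99 = 2 / 10 ^ 2 + 2 / 10 ^ 4 + ...] bounds the sum of the [1 - tanh]. *)
Lemma tanh_lattice_prod n : 97 / 99 <= \prod_(i < n) tanh (i.+1%:R * step / 2).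
Proof.
have q0 : 0 <= q by rewrite invr_ge0.
have x0 k : 0 <= (q ^+ 2) ^+ k by apply: exprn_ge0; exact: exprn_ge0.
suff: 1 - 2 / 99 * (1 - (q ^+ 2) ^+ n) <= \prod_(i < n) tanh (i.+1%:R * step / 2).
  by apply: le_trans; have := x0 n; move: ((q ^+ 2) ^+ n) => x; lra.
elim: n => [|n IH]; first by rewrite big_ord0 expr0 subrr mulr0 subr0.
rewrite big_ord_recr/=; have := tanh_ge_expR (n.+1%:R * step / 2).
rewrite expR_lattice -exprM mulnC exprM => th.
have {}x0 := x0 n.
have x1 : (q ^+ 2) ^+ n <= 1.
  by rewrite exprn_ile1 ?exprn_ge0 ?invr_ge0// exprn_ile1 ?invr_ge0// invf_le1// ler1n.
rewrite exprS in th *; move: x0 x1 th IH; move: ((q ^+ 2) ^+ n) => x x0 x1 th IH.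
apply: le_trans (ler_pM _ _ IH th); rewrite ?expr2; nra.
Qed.

(** The origin [t 0] is left free because the recursion passes to [t \o succn], a lattice with the
    same step; each level contributes at least [97 / 99]. *)
Lemma cholesky_lattice n (t : nat -> R) : (forall k, t k = t 0%N + k%:R * step) ->
  (97 / 99) ^+ n <= cholesky n t.
Proof.
elim: n t => [|n IH] t ht //=.
have k0 : 0 <= 97 / 99 :> R by rewrite divr_ge0.
rewrite exprSr; apply: ler_pM; [exact: exprn_ge0|exact: k0| |].
  apply: IH => k; rewrite /= ht [t 1%N]ht -natr1; ring.
apply: le_trans (tanh_lattice_prod n) _; rewrite le_eqVlt; apply/orP; left; apply/eqP.
by apply: eq_bigr => i _; rewrite (ht i.+1) [t 0%N + _]addrC addrK.
Qed.

End lattice.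

(** * Persistence probabilities *)

Section dyadic.
Context (R : realType).

(** Halving the mesh makes successive grids nested, so the grid events decrease to the
    continuous-time event. *)
Definition dyadic (a T : R) (m k : nat) : R := a + k%:R * (T / 2 ^+ m).

Lemma dyadic_dense (f : R -> R) (a T : R) : continuous f -> 0 <= T ->
  (forall m k, (k <= 2 ^ m)%N -> f (dyadic a T m k) <= 0) ->
  forall s, a <= s <= a + T -> f s <= 0.
Proof.
move=> cf T0 fd s /andP[as_ sT]; rewrite leNgt; apply/negP => fs.
have [T00|Tpos] := leP T 0.
  have Tz : T = 0 by apply/eqP; rewrite eq_le T00.
  have := fd 0%N 0%N isT; rewrite /dyadic mul0r addr0 leNgt.
  have -> : a = s by rewrite Tz addr0 in sT; apply/eqP; rewrite eq_le as_.
  by rewrite fs.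
have /nbhs_ballP[e /= e0 he] : \forall x \near s, 0 < f x.
  by apply: (cvgr_gt (f s) (cf s) 0 fs).
have [m hm] : exists m, T / 2 ^+ m < e.
  have : (2^-1 : R) ^+ m @[m --> \oo] --> (0 : R).
    by apply: cvg_expr; rewrite ger0_norm ?invr_ge0// invf_lt1// ltr1n.
  move=> /cvgrPdist_lt/(_ (e / T)); rewrite divr_gt0// => /(_ isT)[m _ /(_ m (leqnn _))].
  rewrite sub0r normrN ger0_norm ?exprn_ge0 ?invr_ge0// => h.
  by exists m; rewrite -exprVn mulrC -ltr_pdivlMr.
set dl := T / 2 ^+ m in hm.
have dl0 : 0 < dl by rewrite divr_gt0// exprn_gt0.
have sa0 : 0 <= (s - a) / dl by rewrite divr_ge0 ?subr_ge0// ltW.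
have /andP[k1 k2] := truncn_itv sa0; set k := Num.truncn _ in k1 k2.
have k2m : (k <= 2 ^ m)%N.
  rewrite -(ler_nat R) natrX; apply: le_trans k1 _.
  rewrite ler_pdivrMr// /dl mulrC divfK ?expf_neq0//.
  by rewrite lerBlDl.
have := fd m k k2m; rewrite leNgt => /negP; apply; apply: he.
rewrite /ball/= /dyadic -/dl.
rewrite ler_pdivlMr// in k1; rewrite ltr_pdivrMr// -natr1 mulrDl mul1r in k2.
by rewrite opprD addrA ger0_norm ?subr_ge0//; lra.
Qed.

End dyadic.

Section persistence.
Context (R : realType) (d : measure_display) (Omega : measurableType d)
  (P : probability Omega R) (Y : R -> {RV P >-> R}).
Hypothesis hY : sech_gaussian_process Y.
Context (r : R) (hr : process_law Y r).

Definition nonpositive_on (a T : R) : set Omega :=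
  [set w | forall s, a <= s <= a + T -> Y s w <= 0].

Definition nonpositive_grid (a T : R) m : set Omega :=
  [set w | forall k, (k <= 2 ^ m)%N -> Y (dyadic a T m k) w <= 0].

(** [sup] has a default value on sets without an upper bound, so it dominates the path only once the
    path is known to be bounded; continuity on [[0, T]] provides this. *)
Lemma stays_nonpositiveE T : 0 <= T -> stays_nonpositive Y T = nonpositive_on 0 T.
Proof.
move=> T0; have [_ _ _ cY _] := hY.
apply/seteqP; split => w.
  rewrite /stays_nonpositive/= => sup0 s; rewrite add0r => s0T.
  apply: le_trans sup0; apply: ub_le_sup; last by exists s => //=; rewrite in_itv.
  have [|c _ hc] := @EVT_max R (fun t => Y t w) 0 T T0.
    by apply: continuous_subspaceT; exact: cY.
  by exists (Y c w) => _ [t tT <-]; exact: hc.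
move=> H; apply: ge_sup; first by exists (Y 0 w), 0 => //=; rewrite in_itv/= lexx.
by move=> _ [s /= +] <-; rewrite in_itv/= => s0T; apply: H; rewrite add0r.
Qed.

Lemma measurable_le0 s : measurable [set w | Y s w <= 0].
Proof.
rewrite (_ : [set w | _] = Y s @^-1` `]-oo, 0]); last first.
  by apply/seteqP; split => w /=; rewrite in_itv.
by rewrite -[X in measurable X]setTI; apply: (measurable_process Y s).
Qed.

Lemma measurable_nonpositive_grid a T m : measurable (nonpositive_grid a T m).
Proof.
rewrite (_ : nonpositive_grid a T m =
    \bigcap_(k in `I_(2 ^ m).+1) [set w | Y (dyadic a T m k) w <= 0]).
  by apply: fin_bigcap_measurable => // k _; exact: measurable_le0.
by apply/seteqP; split => w /= H k hk; apply: H.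
Qed.

Lemma nonpositive_gridP a T : 0 <= T ->
  \bigcap_m nonpositive_grid a T m = nonpositive_on a T.
Proof.
move=> T0; have [_ _ _ cY _] := hY; apply/seteqP; split => w /= H.
  apply: (dyadic_dense (cY w) T0) => m k hk.
  by have := H m I; apply.
move=> m _ k hk; apply: H; rewrite /dyadic lerDl mulr_ge0 ?divr_ge0 ?exprn_ge0//=.
rewrite lerD2l mulrA ler_pdivrMr ?exprn_gt0// mulrC ler_wpM2l//.
by rewrite -natrX ler_nat.
Qed.

Lemma nonincreasing_nonpositive_grid a T : nonincreasing_seq (nonpositive_grid a T).
Proof.
move=> m m' mm'; apply/subsetPset => w H k hk.
have := H (k * 2 ^ (m' - m))%N; rewrite /dyadic.
have e : (k * 2 ^ (m' - m))%N%:R * (T / 2 ^+ m') = k%:R * (T / 2 ^+ m) :> R.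
  rewrite natrM natrX -[in 2 ^+ m'](subnKC mm') exprD; field.
  by rewrite !expf_neq0.
by rewrite e; apply; rewrite -[in (2 ^ m')%N](subnKC mm') expnD leq_mul2r hk orbT.
Qed.

Lemma measurable_nonpositive_on a T : 0 <= T -> measurable (nonpositive_on a T).
Proof.
move=> T0; rewrite -nonpositive_gridP//; apply: bigcap_measurable => // m _.
exact: measurable_nonpositive_grid.
Qed.

Lemma cvg_nonpositive_grid a T : 0 <= T ->
  P (nonpositive_grid a T m) @[m --> \oo] --> P (nonpositive_on a T).
Proof.
move=> T0; rewrite -nonpositive_gridP//; apply: nonincreasing_cvg_mu.
- by rewrite -ge0_fin_numE// fin_num_measure//; exact: measurable_nonpositive_grid.
- by move=> m; exact: measurable_nonpositive_grid.
- by rewrite nonpositive_gridP//; exact: measurable_nonpositive_on.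
- exact: nonincreasing_nonpositive_grid.
Qed.

Lemma nonpositive_grid_sample a T m : nonpositive_grid a T m =
  sample Y (2 ^ m).+1 (dyadic a T m) @^-1` [set v | forall i, tnth v i <= 0].
Proof.
apply/seteqP; split => w /= H.
  by move=> i; rewrite tnth_mktuple; apply: H; rewrite -ltnS.
by move=> k hk; have := H (Ordinal (hk : (k < (2 ^ m).+1)%N)); rewrite tnth_mktuple.
Qed.

Lemma measurable_sublevel n (D : pred 'I_n) :
  measurable [set v : n.-tuple R | forall i, D i -> tnth v i <= 0].
Proof.
rewrite (_ : [set v | _] =
    \bigcap_(i in [set i | D i]) ((fun v => tnth v i) @^-1` `]-oo, 0])).
  apply: fin_bigcap_measurable => // i _.
  by rewrite -[X in measurable X]setTI; exact: measurable_tnth.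
by apply/seteqP; split => v /= H i Di; have := H i Di; rewrite /= in_itv.
Qed.

Lemma nonpositive_grid_shift a T m :
  P (nonpositive_grid a T m) = P (nonpositive_grid 0 T m).
Proof.
have [_ _ sY _ _] := hY.
rewrite !nonpositive_grid_sample.
have mB : measurable [set v : (2 ^ m).+1.-tuple R | forall i, tnth v i <= 0].
  have := measurable_sublevel (xpredT : pred 'I_(2 ^ m).+1).
  by congr measurable; apply/seteqP; split => v H i //; exact: H.
have := sY _ (fun i : 'I_(2 ^ m).+1 => dyadic 0 T m i) a _ mB.
rewrite (_ : (fun w => [tuple Y (dyadic 0 T m i + a) w | i < (2 ^ m).+1]) =
  sample Y (2 ^ m).+1 (dyadic a T m))//.
apply/funext => w; apply: eq_from_tnth => i; rewrite !tnth_mktuple.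
by rewrite /dyadic add0r addrC.
Qed.

Lemma nonpositive_on_shift a T : 0 <= T -> P (nonpositive_on a T) = P (nonpositive_on 0 T).
Proof.
move=> T0; have := cvg_nonpositive_grid (a := a) T0.
rewrite (_ : (fun m => P _) = fun m => P (nonpositive_grid 0 T m)); last first.
  by apply/funext => m; exact: nonpositive_grid_shift.
by move=> /cvg_lim <-//; apply/cvg_lim => //; exact: cvg_nonpositive_grid.
Qed.

Lemma nonpositive_on_mul S T : 0 <= S -> 0 <= T ->
  (P (nonpositive_on 0 S) * P (nonpositive_on 0 T) <= P (nonpositive_on 0 (S + T)))%E.
Proof.
move=> S0 T0.
have -> : nonpositive_on 0 (S + T) = nonpositive_on 0 S `&` nonpositive_on S T.
  apply/seteqP; split => w /=.
    by move=> H; split=> s /andP[? ?]; apply: H; apply/andP; split; lra.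
  move=> [H1 H2] s /andP[s0 sST]; have [sS|/ltW sS] := leP s S.
    by apply: H1; rewrite s0 add0r.
  by apply: H2; rewrite sS/= -[leRHS]add0r.
rewrite -(nonpositive_on_shift S T0).
have mG a U m := measurable_nonpositive_grid a U m.
have cvgI : P (nonpositive_grid 0 S m `&` nonpositive_grid S T m) @[m --> \oo] -->
    P (nonpositive_on 0 S `&` nonpositive_on S T).
  rewrite -!nonpositive_gridP// -bigcapI; apply: nonincreasing_cvg_mu.
  - by rewrite -ge0_fin_numE// fin_num_measure//; exact: measurableI.
  - by move=> m; exact: measurableI.
  - by apply: bigcap_measurable => // m _; exact: measurableI.
  - move=> m m' mm'; apply/subsetPset; apply: setISS; apply/subsetPset;
      exact: nonincreasing_nonpositive_grid.
have cvgM : (P (nonpositive_grid 0 S m) * P (nonpositive_grid S T m))%E @[m --> \oo] -->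
    (P (nonpositive_on 0 S) * P (nonpositive_on S T))%E.
  apply: cvgeM.
  - by apply: mule_def_fin; rewrite fin_num_measure//; exact: measurable_nonpositive_on.
  - exact: cvg_nonpositive_grid.
  - exact: cvg_nonpositive_grid.
apply: (lee_cvg_to cvgM cvgI); apply: nearW => m.
pose N := (2 ^ m).+1.
(* The two grids are put end to end. Time [S] occurs twice, at indices [N - 1] and [N], so [t] is
   only weakly increasing, which is all that [lower_association] asks. *)
pose t k := if (k < N)%N then dyadic 0 S m k else dyadic S T m (k - N).
have dnd a U : 0 <= U -> {homo (dyadic a U m) : i j / (i <= j)%N >-> i <= j}.
  move=> U0 i j ij; rewrite /dyadic lerD2l ler_wpM2r ?ler_nat//.
  by rewrite divr_ge0// exprn_ge0.
have top : dyadic 0 S m (2 ^ m) = S.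
  by rewrite /dyadic add0r natrX mulrC divfK// expf_neq0.
have ht : {homo t : i j / (i <= j)%N >-> i <= j}.
  move=> i j ij; rewrite /t; case: ltnP => iN; case: ltnP => jN.
  - exact: dnd.
  - apply: (@le_trans _ _ S); first by rewrite -[leRHS]top; exact: dnd.
    by rewrite /dyadic lerDl mulr_ge0// divr_ge0// exprn_ge0.
  - by have := leq_ltn_trans (leq_trans iN ij) jN; rewrite ltnn.
  - by apply: dnd => //; exact: leq_sub2r.
pose A := [set v : (N + N).-tuple R | forall i : 'I_(N + N), (i < N)%N -> tnth v i <= 0].
pose B := [set v : (N + N).-tuple R | forall i : 'I_(N + N), (N <= i)%N -> tnth v i <= 0].
have mA : measurable A by exact: (measurable_sublevel (fun i : 'I_(N + N) => i < N)%N).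
have mB : measurable B by exact: (measurable_sublevel (fun i : 'I_(N + N) => N <= i)%N).
have lA : lower A by move=> u v uv Au i iN; exact: le_trans (uv i) (Au i iN).
have lB : lower B by move=> u v uv Bu i iN; exact: le_trans (uv i) (Bu i iN).
have -> : nonpositive_grid 0 S m = sample Y (N + N) t @^-1` A.
  apply/seteqP; split => w /= H.
    by move=> i iN; rewrite tnth_mktuple /t iN; exact: H.
  move=> k hk; have kN : (k < N + N)%N by rewrite ltn_addl.
  by have := H (Ordinal kN) hk; rewrite tnth_mktuple/= /t ltnS hk.
have -> : nonpositive_grid S T m = sample Y (N + N) t @^-1` B.
  apply/seteqP; split => w /= H.
    move=> i iN; rewrite tnth_mktuple /t ltnNge iN/=; apply: H.
    by rewrite -ltnS -/N ltn_subLR// addnC.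
  move=> k hk; have kN : (N + k < N + N)%N by rewrite ltn_add2l.
  have := H (Ordinal kN) (leq_addr _ _).
  by rewrite tnth_mktuple/= /t ltnNge leq_addr/= addKn.
exact: (lower_association hY hr ht mA mB lA lB).
Qed.

End persistence.

(** * Rational estimates for [pi] and the exponential *)

Section numeric_bounds.
Context (R : realType).

Lemma sin_le_id (y : R) : 0 < y -> sin y <= y.
Proof.
move=> y0; have [|c _] := @MVT R (@sin R) (@cos R) 0 y y0.
  by apply: continuous_subspaceT => x; exact: continuous_sin.
by rewrite sin0 !subr0 => ->; rewrite ler_piMl ?cos_le1// ltW.
Qed.

(** [cos (7 / 5) = 1 - 2 * sin (7 / 10) ^ 2 >= 1 - 98 / 100 > 0], so [7 / 5] lies below [pi / 2]. *)
Lemma pi_ge28 : 14 / 5 <= pi :> R.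
Proof.
rewrite leNgt; apply/negP => hpi.
have p2 := pi_ge2 R.
have : 0 < cos (7 / 5 : R).
  have -> : 7 / 5 = 7 / 10 + 7 / 10 :> R by field.
  have s0 : 0 <= sin (7 / 10 : R) by apply: sin_ge0_pi; apply/andP; split; lra.
  have s1 : sin (7 / 10 : R) <= 7 / 10 by apply: sin_le_id; lra.
  rewrite cosD -!expr2 cos2sin2; nra.
rewrite ltNge => /negP; apply; rewrite -(@cos_pihalf R) leNgt.
rewrite ltr_cos ?in_itv//= -?leNgt; first lra.
  by apply/andP; split; lra.
by apply/andP; split; lra.
Qed.

Lemma expR_neg_7_4 : expR (- (7 / 4)) <= 11 / 60 :> R.
Proof.
have sq (x u v : R) : 0 <= u -> v <= u ^+ 2 -> u <= expR (x / 2) -> v <= expR x.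
  move=> u0 vu ux; apply: le_trans vu _.
  rewrite (_ : expR x = expR (x / 2) ^+ 2); last first.
    by rewrite -expRM_natl; congr expR; field.
  by rewrite ler_pXn2r// nnegrE// (le_trans u0).
have h : 60 / 11 <= expR (7 / 4) :> R.
  (* Read from the bottom: [expR (7 / 128) >= 135 / 128] is squared five times, each square being
     rounded down to a small fraction. *)
  apply: (@sq _ (138 / 59)); [lra|rewrite expr2; lra|].
  apply: (@sq _ (26 / 17)); [lra|rewrite expr2; lra|].
  apply: (@sq _ (47 / 38)); [lra|rewrite expr2; lra|].
  apply: (@sq _ (99 / 89)); [lra|rewrite expr2; lra|].
  apply: (@sq _ (135 / 128)); [lra|rewrite expr2; lra|].
  by apply: le_trans (expR_ge1Dx _); lra.
rewrite expRN (_ : 11 / 60 = (60 / 11)^-1); last by rewrite invf_div.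
by rewrite lef_pV2 ?posrE ?expR_gt0// divr_gt0.
Qed.

End numeric_bounds.

Section persistence_bounds.
Context (R : realType) (d : measure_display) (Omega : measurableType d)
  (P : probability Omega R) (Y : R -> {RV P >-> R}).
Hypothesis hY : sech_gaussian_process Y.
Context (r : R) (hr : process_law Y r).
Notation gamma := (normal_prob 0 1 : probability _ R).

Lemma probability_le0 s : P [set w | Y s w <= 0] = 2^-1%:E.
Proof.
have [r0 _] := hr.
have mn : measurable_fun setT (fun x : R => (x <= 0)%R%:R%:E : \bar R).
  apply/measurable_EFinP; rewrite (_ : (fun _ => _) = \1_(`]-oo, 0]%classic)).
    exact: measurable_indic.
  by apply/funext => x; rewrite indicE mem_setE in_itv.
rewrite -(setIT [set w | _]) -(integral_indic P measurableT (measurable_le0 Y s)).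
transitivity (\int[P]_w ((Y s w <= 0)%R%:R%:E))%E.
  apply: eq_integral => w _; rewrite indicE; congr (nat_of_bool _)%:R%:E.
  by apply/idP/idP => [/set_mem|h]//; exact/mem_set.
rewrite (process_law1 hr s mn); last by move=> x; rewrite lee_fin.
rewrite -[RHS](normal_prob_neg R); apply: eq_integral => x _.
by rewrite pmulr_rle0.
Qed.

Lemma grid_lower_bound (dl : R) n : 0 < dl ->
  ((2^-1 - n%:R * (dl / 2 * expR (dl / 2) / (2 * pi)))%:E <=
   P [set w | forall k, (k <= n)%N -> (Y (k%:R * dl) w <= 0)%R])%E.
Proof.
move=> dl0; set c := dl / 2 * _ / _.
pose S m := [set w | forall k, (k <= m)%N -> Y (k%:R * dl) w <= 0].
have mS m : measurable (S m).
  rewrite (_ : S m = \bigcap_(k in `I_m.+1) [set w | Y (k%:R * dl) w <= 0]).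
    by apply: fin_bigcap_measurable => // k _; exact: measurable_le0.
  by apply/seteqP; split => w /= H k hk; apply: H.
rewrite -/(S n); elim: n => [|n IH].
  rewrite mul0r subr0 -(probability_le0 0); apply: le_measure; rewrite ?inE//.
    exact: measurable_le0.
  by move=> w /= Y0 k; rewrite leqn0 => /eqP ->; rewrite mul0r.
pose C := [set w | Y (n%:R * dl) w <= 0 < Y (n.+1%:R * dl) w].
have mC : measurable C.
  rewrite (_ : C = [set w | Y (n%:R * dl) w <= 0] `\` [set w | Y (n.+1%:R * dl) w <= 0]).
    by apply: measurableD; exact: measurable_le0.
  apply/seteqP; split => w /=; first by move=> /andP[h1]; rewrite ltNge => /negP.
  by move=> [h1 /negP]; rewrite -ltNge => h2; apply/andP.
have PC : (P C <= c%:E)%E.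
  apply: le_trans (crossing_probability hY hr (_ : n%:R * dl < n.+1%:R * dl)) _.
    by rewrite ltr_pM2r// ltr_nat.
  rewrite lee_fin (_ : n.+1%:R * dl - n%:R * dl = dl); last by rewrite -natr1; ring.
  by rewrite ler_wpM2r ?sinh_le// invr_ge0 mulr_ge0// pi_ge0.
have : (P (S n) <= P (S n.+1) + P C)%E.
  apply: (@le_trans _ _ (P (S n.+1 `|` C))); last exact: measureU2.
  apply: le_measure; rewrite ?inE//; first exact: measurableU.
  move=> w Sw; have [Yn|Yn] := leP (Y (n.+1%:R * dl) w) 0; [left|right].
    by move=> k; rewrite leq_eqVlt => /predU1P[->//|]; exact: Sw.
  by rewrite /C/= Yn Sw.
move=> h; have := le_trans IH (le_trans h (leeD (lexx _) PC)).
have : P (S n.+1) \is a fin_num by rewrite fin_num_measure.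
case: (P (S n.+1)) => // p _; rewrite -EFinD !lee_fin -natr1; lra.
Qed.

Lemma persistence_lower_bound : ((11 / 60)%:E <= P (nonpositive_on Y 0 (7 / 2)))%E.
Proof.
have T0 : 0 <= 7 / 2 :> R by rewrite divr_ge0.
apply: (lee_cvg_to (cvg_cst _) (cvg_nonpositive_grid hY (a := 0) T0)).
(* From [m = 8] on, [x <= 7 / 1024], hence [expR x <= 100 / 99]. With [pi >= 14 / 5] the total loss
   [7 / 8 * expR x / pi] is then at most [19 / 60 = 1 / 2 - 11 / 60]. *)
exists 8%N => // m /= m8.
have p0 : (0 : R) < 2 ^+ m by exact: exprn_gt0.
pose x : R := 7 / 4 / 2 ^+ m.
have x0 : 0 < x by rewrite divr_gt0.
have x1 : x <= 1 / 100.
  rewrite ler_pdivrMr// -ler_pdivrMl// -natrX.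
  apply: (@le_trans _ _ (2 ^ 8)%N%:R); last by rewrite ler_nat leq_exp2l.
  rewrite natrX !exprS expr0; lra.
have ex : expR x <= 100 / 99.
  have := expR_ge1Dx (- x); rewrite expRN => h.
  rewrite -[expR x]invrK -[leRHS]invrK lef_pV2 ?posrE ?invr_gt0 ?expR_gt0//.
  by rewrite invf_div; lra.
have dl0 : 0 < 7 / 2 / 2 ^+ m :> R by rewrite divr_gt0.
have := grid_lower_bound (2 ^ m) dl0.
rewrite (_ : [set w | _] = nonpositive_grid Y 0 (7 / 2) m); last first.
  by apply/seteqP; split => w /= H k hk; have := H k hk; rewrite /dyadic add0r.
apply: le_trans; rewrite lee_fin natrX.
rewrite (_ : 7 / 2 / 2 ^+ m / 2 = x); last by rewrite /x; field; rewrite gt_eqF.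
have -> : 2 ^+ m * (x * expR x / (2 * pi)) = 7 / 8 * expR x / pi.
  have := lt0r_neq0 (pi_gt0 R); move: (pi : R) (expR x) => y z y0.
  by rewrite /x; field; rewrite y0 lt0r_neq0.
have p28 := pi_ge28 R.
suff : 7 / 8 * expR x / pi <= 19 / 60 by lra.
rewrite ler_pdivrMr ?pi_gt0//.
apply: (@le_trans _ _ (7 / 8 * (100 / 99))); first by rewrite ler_wpM2l.
lra.
Qed.

(** Factor per grid point: [Num.sqrt lam / 2] with [lam = 13 / 9], over the lower bound [97 / 99]
    for one level of [cholesky]. *)
Definition decay : R := Num.sqrt (13 / 9) / 2 / (97 / 99).

Lemma persistence_upper_bound n : (P (nonpositive_on Y 0 (n%:R * step R)) <= (decay ^+ n)%:E)%E.
Proof.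
have s0 := step_gt0 R.
pose t k : R := k%:R * step R.
have ht k : t k = t 0%N + k%:R * step R by rewrite /t mul0r add0r.
have hlt : {homo t : i j / (i < j)%N >-> i < j}.
  by move=> i j ij; rewrite /t ltr_pM2r// ltr_nat.
have lam0 : 0 < 13 / 9 :> R by rewrite divr_gt0.
have := probability_nonpositive_le hY hr hlt lam0 (fun y => covq_lattice n y ht).
move=> h; apply: (@le_trans _ _ (P [set w | forall i, (i < n)%N -> Y (t i) w <= 0])).
  apply: le_measure; rewrite ?inE.
  - by apply: measurable_nonpositive_on => //; rewrite mulr_ge0// ltW.
  - rewrite (_ : [set w | _] = \bigcap_(k in `I_n) [set w | Y (t k) w <= 0]).
      by apply: fin_bigcap_measurable => // k _; exact: measurable_le0.
    by apply/seteqP; split => w /= H k hk; apply: H.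
  - move=> w H i iltn; apply: H; rewrite add0r /t; apply/andP; split.
      by rewrite mulr_ge0// ltW.
    by rewrite ler_pM2r// ler_nat ltnW.
apply: le_trans h _; rewrite lee_fin /decay [leRHS]expr_div_n.
rewrite ler_wpM2l ?exprn_ge0 ?divr_ge0//.
rewrite lef_pV2 ?posrE; [exact: cholesky_lattice|exact: cholesky_gt0|].
by rewrite exprn_gt0// divr_gt0.
Qed.

Lemma decay_gt0 : 0 < decay.
Proof. by rewrite !divr_gt0// sqrtr_gt0 divr_gt0. Qed.

(** Since [step R / 10] is [ln 100 / 10], the claim amounts to [decay ^+ 10 <= 1 / 100]; squaring
    first removes the root. *)
Lemma ln_decay : ln decay <= - (step R / 10).
Proof.
have d0 := decay_gt0.
have d2 : decay ^+ 2 <= 38 / 100.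
  rewrite /decay !expr_div_n sqr_sqrtr ?divr_ge0//; lra.
have d10 : decay ^+ 10 <= 1 / 100.
  rewrite -[decay ^+ _]/(decay ^+ (2 * 5)) exprM.
  have x0 : 0 <= decay ^+ 2 by rewrite exprn_ge0// ltW.
  move: (decay ^+ 2) x0 d2 => x x0 x1.
  have x2 : x * x <= 29 / 200 by apply: le_trans (ler_pM x0 x0 x1 x1) _; lra.
  have x4 : x * x * (x * x) <= 22 / 1000.
    by apply: le_trans (ler_pM _ _ x2 x2) _; rewrite ?mulr_ge0//; lra.
  rewrite (_ : x ^+ 5 = x * x * (x * x) * x); last by rewrite !exprS expr0; ring.
  by apply: le_trans (ler_pM _ _ x4 x1) _; rewrite ?mulr_ge0 ?mulr_ge0//; lra.
have : ln (decay ^+ 10) <= ln (1 / 100).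
  by rewrite ler_ln ?posrE ?exprn_gt0// divr_gt0.
rewrite lnXn// div1r lnV ?posrE//.
have -> : ln 100 = ln 10 *+ 2 :> R by rewrite -lnXn// expr2 -natrM.
rewrite /step -[leLHS]mulr_natl -(mulr_natl (ln 10)).
by move: (ln decay) (ln 10) => u v; lra.
Qed.

End persistence_bounds.

(** * Fekete's lemma and the conclusion *)

Section superadditive_limit.
Context (R : realType).

(* Fekete's lemma, with monotonicity in place of measurability. *)
Lemma superadditive_cvg (f : R -> R) :
  (forall S T, 0 <= S -> 0 <= T -> f S + f T <= f (S + T)) ->
  (forall S T, 0 <= S -> S <= T -> f T <= f S) ->
  (forall T, 0 <= T -> f T <= 0) ->
  let A := [set f T / T | T in [set T | 0 < T]] in
  f T / T @[T --> +oo] --> sup A.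
Proof.
move=> fD fle f0 A.
have subA : has_sup A.
  split; first by exists (f 1 / 1); exists 1 => /=.
  exists 0 => _ [T /= T0 <-]; by rewrite pmulr_lle0 ?invr_gt0// f0// ltW.
have fM S n : 0 <= S -> n.+1%:R * f S <= f (n.+1%:R * S).
  move=> S0; elim: n => [|n IH]; first by rewrite !mul1r.
  rewrite -(natr1 n.+1) !mulrDl !mul1r.
  by apply: le_trans (fD _ _ _ _) => //; [rewrite lerD2r|rewrite mulr_ge0].
apply/cvgrPdist_le => /= e e0.
have [_ [S /= S0 <-] hS] := sup_adherent (divr_gt0 e0 (ltr0Sn R 1)) subA.
near=> T.
have T0 : 0 < T by near: T; exact: nbhs_pinfty_gt.
have le1 : f T / T <= sup A by apply: sup_upper_bound => //; exists T.
have hT : (e / 2)^-1 * - f S <= T.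
  by near: T; apply: nbhs_pinfty_ge; exact: num_real.
rewrite ger0_norm ?subr_ge0//.
set n := Num.truncn (T / S).
have /andP[n1 n2] : n%:R <= T / S < n.+1%:R.
  by apply: truncn_itv; rewrite divr_ge0// ltW.
have TS : T <= n.+1%:R * S by rewrite -ler_pdivrMr// ltW.
have h1 : n.+1%:R * f S <= f T.
  by apply: le_trans (fM S n (ltW S0)) _; apply: fle => //; exact: ltW.
(* Rounding [T / S] up costs at most one extra copy of the nonpositive [f S], that is [f S / T]
   after division, which [hT] makes at least [- e / 2]. *)
have h2 : (T / S + 1) * f S <= f T.
  apply: le_trans h1; rewrite -natr1.
  by apply: ler_wnM2r; [apply: f0; exact: ltW|rewrite lerD2r].
have h3 : f S / S + f S / T <= f T / T.
  rewrite ler_pdivlMr//; apply: le_trans h2.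
  rewrite le_eqVlt; apply/orP; left; apply/eqP; field.
  by rewrite !lt0r_neq0.
have h4 : - (e / 2) <= f S / T.
  by rewrite ler_pdivlMr// mulNr lerNl -ler_pdivrMl ?divr_gt0.
lra.
Unshelve. all: by end_near. Qed.

End superadditive_limit.

Theorem lemma2p5 (R : realType) (d : measure_display)
    (Omega : measurableType d) (P : probability Omega R)
    (Y : R -> {RV P >-> R}) (hY : sech_gaussian_process Y) :
  exists l : R,
    ((T^-1)%:E * lne (P (stays_nonpositive Y T)))%E @[T --> +oo] --> l%:E /\
    (let b := - 4 * l in 2 / 5 <= b <= 2).
Proof.
have [r hr] : exists r, process_law Y r.
  by have [r r0 hr] := process_scale hY; exists r; split.
pose p T := fine (P (nonpositive_on Y 0 T)).
have pE T : 0 <= T -> P (nonpositive_on Y 0 T) = (p T)%:E.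
  by move=> T0; rewrite fineK// fin_num_measure//; exact: measurable_nonpositive_on.
have ple S T : 0 <= S -> S <= T -> p T <= p S.
  move=> S0 ST; have T0 := le_trans S0 ST.
  rewrite -lee_fin -!pE//; apply: le_measure; rewrite ?inE.
  - exact: measurable_nonpositive_on.
  - exact: measurable_nonpositive_on.
  - move=> w H s /andP[s0 sS]; apply: H; rewrite s0/=.
    by apply: le_trans sS _; rewrite lerD2l.
have pM S T : 0 <= S -> 0 <= T -> p S * p T <= p (S + T).
  move=> S0 T0; rewrite -lee_fin EFinM -!pE ?addr_ge0//.
  exact: (nonpositive_on_mul hY hr).
have p72 : 11 / 60 <= p (7 / 2).
  by rewrite -lee_fin -pE ?divr_ge0//; exact: persistence_lower_bound hr.
have p1 T : 0 <= T -> p T <= 1.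
  by move=> T0; rewrite -lee_fin -pE//; apply: probability_le1; exact: measurable_nonpositive_on.
have c0 : 0 < 7 / 2 :> R by rewrite divr_gt0.
have pos T : 0 <= T -> 0 < p T.
  (* Positivity, needed for the logarithm, spreads from [7 / 2] to its multiples by
     supermultiplicativity, then to every [T] by monotonicity. *)
  move=> T0; have h n : 0 < p (n.+1%:R * (7 / 2)).
    elim: n => [|n IH]; first by rewrite mul1r (lt_le_trans _ p72)// divr_gt0.
    rewrite -natr1 mulrDl mul1r; apply: lt_le_trans (pM _ _ _ _).
    - by rewrite mulr_gt0// (lt_le_trans _ p72)// divr_gt0.
    - by rewrite mulr_ge0// ltW.
    - exact: ltW.
  apply: lt_le_trans (h (Num.truncn (T / (7 / 2)))) _; apply: ple => //.
  by rewrite -ler_pdivrMr// ltW// truncnS_gt.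
pose f T := ln (p T).
have fD S T : 0 <= S -> 0 <= T -> f S + f T <= f (S + T).
  move=> S0 T0; rewrite /f -lnM ?posrE ?pos//.
  by rewrite ler_ln ?posrE ?mulr_gt0 ?pos ?addr_ge0// pM.
have fle S T : 0 <= S -> S <= T -> f T <= f S.
  by move=> S0 ST; rewrite /f ler_ln ?posrE ?pos ?ple// (le_trans S0).
have f0 T : 0 <= T -> f T <= 0 by move=> T0; rewrite /f ln_le0// p1.
have /= cf := superadditive_cvg fD fle f0.
set l := sup _ in cf; exists l; split.
  have cE : (f T / T)%:E @[T --> +oo] --> l%:E by apply: cvg_EFin => //; near=> T.
  apply: cvg_trans cE; apply: near_eq_cvg; near=> T.
  have T0 : 0 < T by near: T; exact: nbhs_pinfty_gt.
  rewrite /= stays_nonpositiveE ?ltW// pE ?ltW// lne_EFin ?pos ?ltW//.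
  by rewrite -EFinM mulrC.
have l1 : - (1 / 2) <= l.
  apply: (@le_trans _ _ (f (7 / 2) / (7 / 2))).
    rewrite ler_pdivlMr// /f -[leLHS]expRK ler_ln ?posrE ?expR_gt0 ?(pos _ (ltW c0))//.
    apply: le_trans p72; rewrite (_ : _ * _ = - (7 / 4)); last by field.
    exact: expR_neg_7_4.
  apply: sup_upper_bound; last by exists (7 / 2).
  split; first by exists (f 1 / 1); exists 1 => /=.
  by exists 0 => _ [T /= T0 <-]; rewrite pmulr_lle0 ?invr_gt0// f0// ltW.
have s0 := step_gt0 R.
have l2 : l <= - (1 / 10).
  (* If [l > - 1 / 10], then [f T / T > - 1 / 10] for all large [T]; a large multiple of [step R]
     contradicts this by [persistence_upper_bound] and [ln_decay]. *)
  rewrite leNgt; apply/negP => /(cvgr_gt _ cf) [M [_ hM]].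
  pose n := Num.truncn (M / step R); pose T := n.+1%:R * step R.
  have T0 : 0 < T by rewrite mulr_gt0.
  have /hM/= : M < T by rewrite -ltr_pdivrMr// truncnS_gt.
  apply/negP; rewrite -leNgt ler_pdivrMr//.
  have : p T <= decay R ^+ n.+1.
    by rewrite -lee_fin -(pE _ (ltW T0)); exact: (persistence_upper_bound hY hr).
  rewrite -ler_ln ?posrE ?(pos _ (ltW T0)) ?exprn_gt0 ?decay_gt0// lnXn ?decay_gt0// => h.
  apply: le_trans h _; rewrite -[leLHS]mulr_natl /T mulrCA ler_pM2l//.
  by apply: le_trans (ln_decay R) _; rewrite div1r mulNr mulrC.
by apply/andP; split; lra.
Unshelve. all: by end_near. Qed.
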